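(* Let $(X,D,F)$ be a sub-Finsler manifold with $X$ three-dimensional and $D$ an oriented rank-two contact distribution. Let $\tilde\gamma:[0,\ell]\to Y$ be a lifted geodesic with 2-parameter admissible variation $\tilde\gamma_{t,u}$. Then the Hessian of the length functional evaluated at the infinitesimal admissible variations $V=\sum_{i=1}^5V_ie_i$ and $W=\sum_{i=1}^5W_ie_i$ is $$\mathcal L_{**}(V,W)=\int_0^\ell W_3\,J(V_3)\,ds,$$ where $J$ is a self-adjoint fourth-order differential operator on the space of smooth functions on $[0,\ell]$ given by $$J(u)=\ddddot{u}+\frac{d}{ds}\bigl(P\,\dot u\bigr)+Q\,u$$ for certain functions $P,Q$ along $\tilde\gamma$ (depending on $\tilde\gamma$ but not on the variation), dots denoting derivatives with respect to $s$.
   Context: Setting. $X$ is a smooth 3-manifold and $D\subset TX$ is a rank-two contact distribution: for any local vector fields $v_1,v_2$ spanning $D$, the vectors $v_1,v_2,[v_1,v_2]$ span $TX$ at each point. A sub-Finsler metric on $D$ is a function $F:D\to[0,\infty)$, smooth away from the zero section, with $F(cv)=cF(v)$ for $c>0$, and such that the Hessian of $\tfrac12F^2$ restricted to each $D_x$ is positive definite on $D_x\setminus\{0\}$. Its indicatrix bundle is the 4-manifold $\Sigma=\{u\in D: F(u)=1\}$, with basepoint projection $\pi:\Sigma\to X$. The length of a horizontal curve $\gamma:[a,b]\to X$ (tangent to $D$) is $\mathcal L(\gamma)=\int_a^bF(\gamma'(t))\,dt$. Adapted coframings. A vector $v\in T_u\Sigma$ is monic if $\pi'(u)(v)=u$.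 A 1-form on $\Sigma$ is monic if it takes the value $1$ on all monic vectors; a nonvanishing 1-form is null if it vanishes on all monic vectors. A local coframing $(\eta^1,\eta^2,\eta^3,\phi)$ of $\Sigma$ is 0-adapted if $\eta^1$ is monic, $\eta^2,\eta^3$ are null, and $D=\{\eta^3\}^\perp$ (i.e. $\ker \eta^3_u=\pi'(u)^{-1}(D)$). It is 4-adapted if it is 0-adapted and there are functions $I,J_1,J_2,K,A_1,A_2,S_0,S_1,S_2$ with $$\begin{aligned} d\eta^1&=\eta^2\wedge\phi+A_1\eta^2\wedge\eta^3+(A_2+\tfrac12IK)\eta^3\wedge\eta^1+J_1\eta^3\wedge\phi,\\ d\eta^2&=-\eta^1\wedge\phi+(A_2-\tfrac12IK)\eta^2\wedge\eta^3-A_1\eta^3\wedge\eta^1+J_2\eta^3\wedge\phi+I\eta^2\wedge\phi,\\ d\eta^3&=\eta^1\wedge\eta^2+I\eta^3\wedge\phi,\\ d\phi&=S_0\eta^3\wedge\phi+S_1\eta^2\wedge\eta^3+S_2\eta^3\wedge\eta^1-J_1\eta^1\wedge\phi-2J_2\eta^2\wedge\phi+K\eta^1\wedge\eta^2. \end{aligned}$$ 4-adapted coframings exist near every point of $\Sigma$ and are unique up to $(\eta^1,\eta^2,\eta^3,\phi)\mapsto(\eta^1,\epsilon\eta^2,\epsilon\eta^3,\epsilon\phi)$, $\epsilon=\pm1$. An orientation of $D$ is fixed, and $\mathcal{B}_4$ denotes the manifold of 4-adapted coframes preserving it, carrying the canonical coframing $(\eta^1,\eta^2,\eta^3,\phi)$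 satisfying these equations. The manifold $Y$ and geodesics. Let $Y=\mathcal{B}_4\times\mathbb R$ with coordinate $\lambda$ on $\mathbb R$, basepoint projection $\pi:Y\to X$, and coframing $(\eta^1,\dots,\eta^5)$ where $\eta^4=\phi-\lambda\eta^1$ and $\eta^5=d\lambda-(\lambda^2I+\lambda J_1+A_2+\tfrac12IK)\eta^1$; let $(e_1,\dots,e_5)$ be the dual framing. Each horizontal curve $\gamma$ lifts canonically to an integral curve $\bar\gamma$ of $\{\eta^2,\eta^3\}$ on $\mathcal{B}_4$ (the 4-adapted coframe for which the vector dual to $\eta^1$ points along the velocity), and then to an integral curve $\tilde\gamma$ of $\{\eta^2,\eta^3,\eta^4\}$ on $Y$. The length of $\gamma$ is $\int_{\tilde\gamma}\eta^1$. A unit speed horizontal curve $\gamma$ is a (sub-Finsler) geodesic if $\tilde\gamma$ is an integral curve of $\{\eta^2,\eta^3,\eta^4,\eta^5\}$; then $\tilde\gamma$ is called a lifted geodesic, and $s$ denotes arc length. Variations. Let $\gamma:[0,\ell]\to X$ be a geodesic from $p$ to $q$, and $\gamma_{t,u}$ a smooth 2-parameter variation of $\gamma=\gamma_{0,0}$ through horizontal curves with fixed endpoints $p,q$. Its lift $\tilde\gamma_{t,u}$ to $Y$ (through integral curves of $\{\eta^2,\eta^3,\eta^4\}$, with $\pi\circ\tilde\gamma_{t,u}(0)=p$, $\pi\circ\tilde\gamma_{t,u}(\ell)=q$) is called an admissible variation, and $V(s)=\partial_t\tilde\gamma_{t,u}(s)|_{t=u=0}=\sum V_i(s)e_i(s)$,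 $W(s)=\partial_u\tilde\gamma_{t,u}(s)|_{t=u=0}=\sum W_i(s)e_i(s)$ are its infinitesimal admissible variations. The Hessian is $\mathcal L_{**}(V,W)=\dfrac{\partial^2}{\partial t\,\partial u}\mathcal L(\gamma_{t,u})\big|_{t=u=0}$. For infinitesimal admissible variations $V_3,W_3$ vanish to first order at $0$ and $\ell$; self-adjointness of $J$ is understood as formal self-adjointness with respect to the $L^2$ inner product on smooth functions on $[0,\ell]$ vanishing to first order (value and first derivative) at both endpoints. *)

(* Defs.v *)
From HB Require Import structures.
From mathcomp Require Import all_boot all_order all_algebra.
From mathcomp Require Import all_classical all_reals all_analysis.

Set Implicit Arguments.
Unset Strict Implicit.
Unset Printing Implicit Defensive.

Import Order.TTheory GRing.Theory Num.Theory.
Import numFieldNormedType.Exports.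

Local Open Scope classical_set_scope.
Local Open Scope ring_scope.

(** * Smooth maps between normed spaces *)

Definition iter_derive (R : realType) (V W : normedModType R)
    (vs : seq V) (f : V -> W) : V -> W :=
  foldr (fun v (g : V -> W) => 'D_v g) f vs.

(* C^infinity on an open set [O]: all iterated directional derivatives exist
   and are Frechet differentiable (hence continuous) at every point of [O].
   Only used for open [O]. *)
Definition smooth_on (R : realType) (V W : normedModType R)
    (O : set V) (f : V -> W) : Prop :=
  forall (vs : seq V) (x : V), O x -> differentiable (iter_derive vs f) x.

(** * Manifolds *)

(* [coord i] is a chart on the open set [cdom i], with inverse [par i]; both
   are unspecified elsewhere.  [chart_at x] is a preferred chart around [x],
   used only to name tangent vectors: the tangent space at [x] is ['rV_n], a
   vector being its list of coordinates in the chart [chart_at x]. *)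
Record manifold (R : realType) (n : nat) := Manifold {
  mpt :> topologicalType;
  chart : Type;
  cdom : chart -> set mpt;
  coord : chart -> mpt -> 'rV[R]_n;
  par : chart -> 'rV[R]_n -> mpt;
  chart_at : mpt -> chart;
  manifold_hausdorff : hausdorff_space mpt;
  manifold_countable : @second_countable mpt;
  chart_atP : forall x, cdom (chart_at x) x;
  cdom_open : forall i, open (cdom i);
  cim_open : forall i, open (coord i @` cdom i);
  coordK : forall i x, cdom i x -> par i (coord i x) = x;
  coord_continuous : forall i x, cdom i x -> {for x, continuous (coord i)};
  par_continuous : forall i y,
    (coord i @` cdom i) y -> {for y, continuous (par i)};
  chart_smooth : forall i j,
    smooth_on (coord i @` (cdom i `&` cdom j)) (coord j \o par i) }.

Section Calculus.
Context {R : realType} {n : nat} {M : manifold R n}.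

Definition cim (i : chart M) : set 'rV[R]_n := coord i @` cdom i.

(* Coordinates in the chart [i] of a tangent vector at [x]. *)
Definition tcoord (i : chart M) (x : M) (v : 'rV[R]_n) : 'rV[R]_n :=
  'D_v (coord i \o par (chart_at x)) (coord (chart_at x) x).

Definition smooth_map (V : normedModType R) (O : set V) (c : V -> M) : Prop :=
  (forall x, O x -> {for x, continuous c}) /\
  forall i, smooth_on (O `&` c @^-1` cdom i) (coord i \o c).

(* The tangent vector at [c x] which is the derivative of [c] along [v]. *)
Definition tder (V : normedModType R) (c : V -> M) (x v : V) : 'rV[R]_n :=
  'D_v (coord (chart_at (c x)) \o c) x.

(* Smoothness of [x |-> (c x, w x)] as a map to the tangent bundle. *)
Definition smooth_tmap (V : normedModType R) (O : set V)
    (c : V -> M) (w : V -> 'rV[R]_n) : Prop :=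
  smooth_map O c /\
  forall i, smooth_on (O `&` c @^-1` cdom i) (fun x => tcoord i (c x) (w x)).

Definition smooth_fun (g : M -> R) : Prop :=
  forall i, smooth_on (cim i) (g \o par i : 'rV[R]_n -> R).

Definition field_in (i : chart M) (v : M -> 'rV[R]_n) (y : 'rV[R]_n) :
    'rV[R]_n := tcoord i (par i y) (v (par i y)).

Definition smooth_field (U : set M) (v : M -> 'rV[R]_n) : Prop :=
  forall i, smooth_on (coord i @` (cdom i `&` U)) (field_in i v).

Definition lie (v w : M -> 'rV[R]_n) (x : M) : 'rV[R]_n :=
  let i := chart_at x in
  'D_(v x) (field_in i w) (coord i x) - 'D_(w x) (field_in i v) (coord i x).

Definition form1 := M -> 'cV[R]_n.

Definition ap (a : form1) (x : M) (v : 'rV[R]_n) : R := (v *m a x) 0 0.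

(* The coefficient [y |-> (par i)^* a (w)] of the pull-back of [a]. *)
Definition form_in (i : chart M) (a : form1) (w y : 'rV[R]_n) : R :=
  ap a (par i y) (tder (par i) y w).

Definition smooth_form (a : form1) : Prop :=
  forall i w, smooth_on (cim i) (form_in i a w).

(* The exterior derivative [da(v, w)] at [x]: in the preferred chart at [x],
   [v] and [w] extend to constant, hence commuting, vector fields. *)
Definition extd (a : form1) (x : M) (v w : 'rV[R]_n) : R :=
  let i := chart_at x in
  'D_v (form_in i a w) (coord i x) - 'D_w (form_in i a v) (coord i x).

Definition wedge (a b : form1) (x : M) (v w : 'rV[R]_n) : R :=
  ap a x v * ap b x w - ap a x w * ap b x v.

End Calculus.

Arguments form1 {R n} M.

Definition tdiff (R : realType) (m n : nat) (M : manifold R m)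
    (N : manifold R n) (f : M -> N) (x : M) (v : 'rV[R]_m) : 'rV[R]_n :=
  tder (f \o par (chart_at x)) (coord (chart_at x) x) v.

(** * Sub-Finsler structures *)

Section SubFinsler.
Context {R : realType} (X : manifold R 3).
Implicit Types (D : X -> {vspace 'rV[R]_3}) (F : X -> 'rV[R]_3 -> R).

Definition spans_on D (U : set X) (v w : X -> 'rV[R]_3) : Prop :=
  forall x, U x -> D x = <<[:: v x; w x]>>%VS.

Record contact_distribution D : Prop := {
  contact_rank : forall x, \dim (D x) = 2%N;
  contact_frame : forall x, exists (U : set X) (v w : X -> 'rV[R]_3),
    [/\ open U, U x, smooth_field U v, smooth_field U w & spans_on D U v w];
  contact_bracket : forall (U : set X) (v w : X -> 'rV[R]_3),
    open U -> smooth_field U v -> smooth_field U w -> spans_on D U v w ->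
    forall x, U x -> <<[:: v x; w x; lie v w x]>>%VS = fullv }.

(* [pos x v w]: (v, w) is a positively oriented basis of D_x. *)
Record orientation D (pos : X -> 'rV[R]_3 -> 'rV[R]_3 -> Prop) : Prop := {
  orient_basis : forall x v w, pos x v w -> D x = <<[:: v; w]>>%VS;
  orient_det : forall x v w (a b c d : R), pos x v w ->
    (pos x (a *: v + b *: w) (c *: v + d *: w) <-> 0 < a * d - b * c);
  orient_frame : forall x, exists (U : set X) (v w : X -> 'rV[R]_3),
    [/\ open U, U x, smooth_field U v, smooth_field U w
      & forall y, U y -> pos y (v y) (w y)] }.

(* [F x v] is only meaningful for [v] in [D x].  Smoothness on the manifold
   D \ 0 is tested on all its smooth parametrized subsets
   [y |-> (c y, w y)] (among them the charts of D \ 0).  The Hessian of F^2/2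
   on D_x at [v], on the diagonal, is the second derivative along [w]. *)
Record sub_finsler D F : Prop := {
  finsler_ge0 : forall x v, v \in D x -> 0 <= F x v;
  finsler_smooth : forall (m : nat) (O : set 'rV[R]_m)
      (c : 'rV[R]_m -> X) (w : 'rV[R]_m -> 'rV[R]_3),
    open O -> smooth_tmap O c w ->
    (forall y, O y -> w y \in D (c y) /\ w y != 0) ->
    smooth_on O (fun y => F (c y) (w y));
  finsler_homogeneous : forall x v (c : R), v \in D x -> 0 < c ->
    F x (c *: v) = c * F x v;
  finsler_convex : forall x v w, v \in D x -> v != 0 -> w \in D x -> w != 0 ->
    0 < 'D_w ('D_w (fun v' : 'rV[R]_3 => 2^-1 * F x v' ^+ 2)) v }.

End SubFinsler.

(** * The indicatrix bundle and its adapted coframings *)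

Section Adapted.
Context {R : realType} (X : manifold R 3).
Variables (D : X -> {vspace 'rV[R]_3}) (F : X -> 'rV[R]_3 -> R).
Variable pos : X -> 'rV[R]_3 -> 'rV[R]_3 -> Prop.
Variable Sigma : manifold R 4.
Variables (pr : Sigma -> X) (vec : Sigma -> 'rV[R]_3).

(* [Sigma] is the submanifold {u in D : F u = 1} of TX: [u |-> (pr u, vec u)]
   is an injective immersion into TX with that image.  Since the image is an
   embedded submanifold of the same dimension 4, this is a diffeomorphism
   onto it. *)
Record indicatrix : Prop := {
  indicatrix_smooth : forall i : chart Sigma,
    smooth_tmap (cim i) (pr \o par i) (vec \o par i);
  indicatrix_inj : forall u u', pr u = pr u' -> vec u = vec u' -> u = u';
  indicatrix_unit : forall u, vec u \in D (pr u) /\ F (pr u) (vec u) = 1;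
  indicatrix_surj : forall x v, v \in D x -> F x v = 1 ->
    exists2 u, pr u = x & vec u = v :> 'rV[R]_3;
  indicatrix_immersion : forall u (v : 'rV[R]_4), tdiff pr u v = 0 ->
    'D_v (fun y => tcoord (chart_at (pr u))
                     (pr (par (chart_at u) y)) (vec (par (chart_at u) y)))
         (coord (chart_at u) u) = 0 ->
    v = 0 }.

Definition monic_vector (u : Sigma) (v : 'rV[R]_4) : Prop :=
  tdiff pr u v = vec u.

Definition monic_form (a : form1 Sigma) : Prop :=
  forall u v, monic_vector u v -> ap a u v = 1.

Definition null_form (a : form1 Sigma) : Prop :=
  (forall u, a u != 0) /\ forall u v, monic_vector u v -> ap a u v = 0.

Record coframe := Coframe {
  eta1 : form1 Sigma; eta2 : form1 Sigma; eta3 : form1 Sigma;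
  phi : form1 Sigma }.

Record coframing (C : coframe) : Prop := {
  coframing_smooth : [/\ smooth_form (eta1 C), smooth_form (eta2 C),
    smooth_form (eta3 C) & smooth_form (phi C)];
  coframing_free : forall u v, ap (eta1 C) u v = 0 -> ap (eta2 C) u v = 0 ->
    ap (eta3 C) u v = 0 -> ap (phi C) u v = 0 -> v = 0 }.

Record adapted0 (C : coframe) : Prop := {
  adapted0_coframing : coframing C;
  adapted0_monic : monic_form (eta1 C);
  adapted0_null2 : null_form (eta2 C);
  adapted0_null3 : null_form (eta3 C);
  adapted0_ker : forall u v,
    ap (eta3 C) u v = 0 <-> tdiff pr u v \in D (pr u) }.

Record invariants := Invariants {
  fI : Sigma -> R; fJ1 : Sigma -> R; fJ2 : Sigma -> R; fK : Sigma -> R;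
  fA1 : Sigma -> R; fA2 : Sigma -> R;
  fS0 : Sigma -> R; fS1 : Sigma -> R; fS2 : Sigma -> R }.

Record adapted4 (C : coframe) (T : invariants) : Prop := {
  adapted4_adapted0 : adapted0 C;
  adapted4_smooth :
    [/\ smooth_fun (fI T), smooth_fun (fJ1 T), smooth_fun (fJ2 T),
        smooth_fun (fK T) & smooth_fun (fA1 T)] /\
    [/\ smooth_fun (fA2 T), smooth_fun (fS0 T), smooth_fun (fS1 T)
      & smooth_fun (fS2 T)];
  adapted4_eta1 : forall u v w,
    extd (eta1 C) u v w =
      wedge (eta2 C) (phi C) u v w
      + fA1 T u * wedge (eta2 C) (eta3 C) u v w
      + (fA2 T u + 2^-1 * fI T u * fK T u) * wedge (eta3 C) (eta1 C) u v w
      + fJ1 T u * wedge (eta3 C) (phi C) u v w;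
  adapted4_eta2 : forall u v w,
    extd (eta2 C) u v w =
      - wedge (eta1 C) (phi C) u v w
      + (fA2 T u - 2^-1 * fI T u * fK T u) * wedge (eta2 C) (eta3 C) u v w
      - fA1 T u * wedge (eta3 C) (eta1 C) u v w
      + fJ2 T u * wedge (eta3 C) (phi C) u v w
      + fI T u * wedge (eta2 C) (phi C) u v w;
  adapted4_eta3 : forall u v w,
    extd (eta3 C) u v w =
      wedge (eta1 C) (eta2 C) u v w + fI T u * wedge (eta3 C) (phi C) u v w;
  adapted4_phi : forall u v w,
    extd (phi C) u v w =
      fS0 T u * wedge (eta3 C) (phi C) u v w
      + fS1 T u * wedge (eta2 C) (eta3 C) u v w
      + fS2 T u * wedge (eta3 C) (eta1 C) u v w
      - fJ1 T u * wedge (eta1 C) (phi C) u v w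
      - 2 * fJ2 T u * wedge (eta2 C) (phi C) u v w
      + fK T u * wedge (eta1 C) (eta2 C) u v w }.

(* The first two vectors of the dual framing project to a positive basis of D;
   this rules out exactly one of the two coframings related by
   (eta1, e eta2, e eta3, e phi), e = 1 or -1. *)
Definition orientation_preserving (C : coframe) : Prop :=
  forall u (v1 v2 : 'rV[R]_4),
    [/\ ap (eta1 C) u v1 = 1, ap (eta2 C) u v1 = 0, ap (eta3 C) u v1 = 0
      & ap (phi C) u v1 = 0] ->
    [/\ ap (eta1 C) u v2 = 0, ap (eta2 C) u v2 = 1, ap (eta3 C) u v2 = 0
      & ap (phi C) u v2 = 0] ->
    pos (pr u) (tdiff pr u v1) (tdiff pr u v2).

(* Since an oriented 4-adapted coframing is unique, there is exactly one
   oriented 4-adapted coframe at each point of Sigma: the projection B_4 ->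
   Sigma is a diffeomorphism, which carries the canonical coframing of B_4 to
   the globally defined oriented 4-adapted coframing of Sigma.  We use it to
   identify B_4 with Sigma. *)
Definition canonical_coframing (C : coframe) (T : invariants) : Prop :=
  adapted4 C T /\ orientation_preserving C.

(** * The manifold Y = B_4 x R *)

Definition Y : Type := (Sigma * R)%type.

Definition base (y : Y) : X := pr y.1.

Definition smooth_mapY (V : normedModType R) (O : set V) (G : V -> Y) : Prop :=
  smooth_map O (fst \o G) /\ smooth_on O (snd \o G : V -> R).

(* A tangent vector of Y is a pair (tangent vector of Sigma, dlambda). *)
Definition tderY (V : normedModType R) (G : V -> Y) (x v : V) :
    'rV[R]_4 * R :=
  (tder (fst \o G) x v, 'D_v (snd \o G : V -> R) x).

(* The coframing of Y, indexed by 1, ..., 5.  The components of a tangent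
   vector in the dual framing are its values on these forms. *)
Definition etaY (C : coframe) (T : invariants) (k : nat) (y : Y)
    (w : 'rV[R]_4 * R) : R :=
  let: (u, l) := y in
  match k with
  | 1 => ap (eta1 C) u w.1
  | 2 => ap (eta2 C) u w.1
  | 3 => ap (eta3 C) u w.1
  | 4 => ap (phi C) u w.1 - l * ap (eta1 C) u w.1
  | 5 => w.2 - (l ^+ 2 * fI T u + l * fJ1 T u + fA2 T u
                + 2^-1 * fI T u * fK T u) * ap (eta1 C) u w.1
  | _ => 0
  end.

(** * Horizontal curves, geodesics and variations *)

(* Curves on [0, l] are given by maps on an open neighbourhood of [0, l]; only
   their restriction to [0, l] matters, and every map which is smooth on
   [0, l] up to the endpoints has such an extension. *)
Definition near_seg (l e : R) : set R := [set s | - e < s < l + e].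

Definition speed (G : R -> Y) (s : R) : R :=
  F (base (G s)) (tder (base \o G) s 1).

(* On [0, l], [G] is the canonical lift to Y of the horizontal curve
   [base \o G]: its component in Sigma is the direction of the velocity. *)
Definition lift_of_horizontal (C : coframe) (T : invariants) (l : R)
    (G : R -> Y) : Prop :=
  forall s, 0 <= s <= l ->
    [/\ tder (base \o G) s 1 \in D (base (G s)),
        0 < speed G s,
        tder (base \o G) s 1 = speed G s *: vec (G s).1
      & [/\ etaY C T 2 (G s) (tderY G s 1) = 0,
            etaY C T 3 (G s) (tderY G s 1) = 0
          & etaY C T 4 (G s) (tderY G s 1) = 0]].

Definition lifted_geodesic (C : coframe) (T : invariants) (l : R)
    (G : R -> Y) : Prop :=
  [/\ exists2 e : R, 0 < e & smooth_mapY (near_seg l e) G,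
      lift_of_horizontal C T l G,
      forall s, 0 <= s <= l -> speed G s = 1
    & forall s, 0 <= s <= l -> etaY C T 5 (G s) (tderY G s 1) = 0].

Definition near_box (l e : R) : set (R * R * R) :=
  [set z | [/\ - e < z.1.1 < l + e, - e < z.1.2 < e & - e < z.2 < e]].

(* [G (s, t, u)] is the lift to Y of the 2-parameter variation
   [base (G (s, t, u))] of the geodesic [base \o G0]. *)
Definition admissible_variation (C : coframe) (T : invariants) (l : R)
    (G0 : R -> Y) (G : R * R * R -> Y) : Prop :=
  (forall s, 0 <= s <= l -> G (s, 0, 0) = G0 s) /\
  exists e : R, [/\ 0 < e, smooth_mapY (near_box l e) G
    & forall t u, - e < t < e -> - e < u < e ->
      [/\ lift_of_horizontal C T l (fun s => G (s, t, u)),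
          base (G (0, t, u)) = base (G0 0)
        & base (G (l, t, u)) = base (G0 l)]].

Definition infinitesimal_t (G : R * R * R -> Y) (s : R) : 'rV[R]_4 * R :=
  tderY (fun t : R => G (s, t, 0)) 0 1.

Definition infinitesimal_u (G : R * R * R -> Y) (s : R) : 'rV[R]_4 * R :=
  tderY (fun u : R => G (s, 0, u)) 0 1.

Definition curve_length (l : R) (G : R -> Y) : R :=
  \int[lebesgue_measure]_(s in `[0, l]) speed G s.

Definition hessian (l : R) (G : R * R * R -> Y) : R :=
  derive1 (fun t : R =>
    derive1 (fun u : R => curve_length l (fun s => G (s, t, u))) 0) 0.

End Adapted.

(** * Differential operators on a segment *)

Section Operators.
Context {R : realType}.

Definition smooth_seg (l : R) (f : R -> R) : Prop :=
  exists2 e : R, 0 < e & smooth_on (near_seg l e) f.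

Definition vanish1 (l : R) (f : R -> R) : Prop :=
  [/\ f 0 = 0, derive1 f 0 = 0, f l = 0 & derive1 f l = 0].

Definition self_adjoint (l : R) (J : (R -> R) -> R -> R) : Prop :=
  forall f g, smooth_seg l f -> smooth_seg l g -> vanish1 l f -> vanish1 l g ->
    \int[lebesgue_measure]_(s in `[0, l]) (g s * J f s) =
    \int[lebesgue_measure]_(s in `[0, l]) (f s * J g s).

Definition jacobi_op (P Q : R -> R) (f : R -> R) (s : R) : R :=
  derive1n 4 f s + derive1 (fun r => P r * derive1 f r) s + Q s * f s.

End Operators.

(* Main.v *)
Require Import Defs.
From mathcomp Require Import all_boot all_order all_algebra.
From mathcomp Require Import all_classical all_reals all_analysis.
From mathcomp Require Import ring lra.
(* From here on coord denotes the coordinates of a manifold, not those of a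
   vector in a basis. *)
Import Defs.
Set Implicit Arguments.
Unset Strict Implicit.
Unset Printing Implicit Defensive.
Import Order.TTheory GRing.Theory Num.Theory.
Import numFieldNormedType.Exports.
Local Open Scope classical_set_scope.
Local Open Scope ring_scope.

(** Write [a_i], [b_i], [c_i] for the values of the coframing [eta_1, ..., eta_5]
    of Y on the derivatives of a variation [G (s, t, u)] in [s], [t] and [u].
    Horizontality says [a_2 = a_3 = a_4 = 0], and then [a_1] is the speed.

    The argument rests on the one-form [Theta = eta_1 + lambda eta_3].  By the
    structure equations, [d Theta] pairs the s-direction with any variation
    only through [eta_5 /\ eta_3], so that
    [d a_1 / d u = d/ds (c_1 + lambda c_3) - a_5 c_3] ([first_variation]).
    Fixed endpoints make [c_1] and [c_3] vanish there ([vertical_forms]), hence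
    the first derivative of length is [- int a_5 c_3].  Differentiating once
    more at a geodesic, where [a_5 = 0], gives
    [Hessian = int c_3 * (- d a_5 / d t)] ([hessian_integral],
    [derive_first_var]).

    On the geodesic the structure equations of [eta_2], [eta_3], [eta_4] and
    [eta_5] become a linear system for [b_2, ..., b_5] whose inhomogeneous term
    is [d a_5 / d t] ([center_eta2] to [center_eta5]).  The first three
    equations express [b_2], [b_4], [b_5] through [u = b_3] and its derivatives
    up to order three, and the last one turns [- d a_5 / d t] into
    [u'''' + p_2 u'' + p_1 u' + p_0 u]: the coefficient of [u'''] cancels.
    This operator has the form [u'''' + (P u')' + Q u] exactly when
    [p_1 = p_2'].  That identity is not formal; it comes from [d (d Theta) = 0],
    that is from [d (d eta_1) = 0] and [d (d eta_3) = 0] on Sigma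
    ([bianchi_I1] and the lemmas after it), which evaluated along the geodesic
    give [geo_M2] and [geo_M3].  The elimination is [jacobi_reduction]; it
    yields in particular
    [P = 4 L' - 2 L^2 - 3 A_1 + 4 lambda J_2 + lambda^2 + K] with
    [L = lambda I].

    Formal self-adjointness of [u'''' + (P u')' + Q u] is Lagrange's identity
    ([wronskian_derive]).  The analytic ingredients are symmetry of second
    derivatives ([derive_swap]), compatibility of pull-back with the exterior
    derivative ([extd_pull]) and differentiation under the integral sign
    ([derive_under_integral]). *)

(** * Smooth maps *)

Lemma near_eq_differentiable (R : realType) (V W : normedModType R)
    (f g : V -> W) (x : V) :
  (\near x, f x = g x) -> differentiable f x -> differentiable g x.
Proof.
move=> fg df.
have -> : g = f + (g - f) by apply/funext => y; rewrite !fctE addrC subrK.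
apply: differentiableD => //.
have E : (g - f) \o shift x = cst ((g - f) x) + (\0 : V -> W) +o_ (0 : V) id.
  apply/eqaddoE; rewrite funeqE => y /=.
  rewrite !fctE.
  have -> : g x - f x = 0 by rewrite (nbhs_singleton fg) subrr.
  rewrite !add0r /= littleoE // => e e0.
  have fg0 : \forall z \near (0 : V), f (z + x) = g (z + x).
    by move: fg; rewrite (near_shift 0); apply: filterS => z /=; rewrite subr0.
  near=> z; rewrite /= (_ : f (z + x) = g (z + x)); last by near: z.
  by rewrite subrr normr0 mulr_ge0 // ltW.
have cst0 : continuous (\0 : V -> W) by exact: cst_continuous.
apply/diff_locallyP.
by rewrite (diff_unique cst0 E).
Unshelve. all: by end_near. Qed.

(** Differentiability to order [n + 1], recursive in the number of derivatives:
    closure under products and composition goes by induction on [n], whereas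
    along a fixed list of directions a product splits into many terms. *)
Fixpoint smooth_order {R : realType} {V W : normedModType R} (n : nat) (O : set V)
    (f : V -> W) : Prop :=
  (forall x, O x -> differentiable f x) /\
  (if n is m.+1 then forall v, smooth_order m O ('D_v f) else True).

Section Smooth.
Context {R : realType} {V : normedModType R}.
Implicit Types (W : normedModType R) (O : set V).

Lemma iter_derive_rcons W (vs : seq V) v (f : V -> W) :
  iter_derive (rcons vs v) f = iter_derive vs ('D_v f).
Proof. by rewrite /iter_derive foldr_rcons. Qed.

Lemma smooth_on_differentiable W O (f : V -> W) x :
  smooth_on O f -> O x -> differentiable f x.
Proof. by move=> /(_ [::] x). Qed.

Lemma smooth_on_derive W O (f : V -> W) v :
  smooth_on O f -> smooth_on O ('D_v f).
Proof. by move=> sf vs x Ox; rewrite -iter_derive_rcons; exact: sf. Qed.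

(** The last direction of a list is differentiated first, so the list is peeled
    off from its end. *)
Lemma smooth_onP W O (f : V -> W) : smooth_on O f <-> forall n, smooth_order n O f.
Proof.
split=> [sf n|sf vs].
  elim: n f sf => [|n IH] f sf /=; split=> //.
  - by move=> x; exact: smooth_on_differentiable.
  - by move=> x; exact: smooth_on_differentiable.
  - by move=> v; apply: IH; exact: smooth_on_derive.
elim/last_ind: vs f sf => [|vs v IH] f sf x Ox; first by have [/(_ x Ox)] := sf 0%N.
rewrite iter_derive_rcons; apply: IH => // n.
by have [_] := sf n.+1; exact.
Qed.

Lemma smooth_orderW W O (f : V -> W) n : smooth_order n.+1 O f -> smooth_order n O f.
Proof.
elim: n f => [|n IH] f /= [df Df]; split=> //.
by move=> v; apply: IH; exact: Df.
Qed.

Lemma smooth_orderS W O (f : V -> W) n v : smooth_order n.+1 O f -> smooth_order n O ('D_v f).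
Proof. by case=> _; exact. Qed.

Lemma smooth_order_diff W O (f : V -> W) n x : smooth_order n O f -> O x -> differentiable f x.
Proof. by case: n => [|n] [df _]; exact: df. Qed.

Lemma smooth_order_ext W O (f g : V -> W) n : open O -> (forall x, O x -> f x = g x) ->
  smooth_order n O f -> smooth_order n O g.
Proof.
move=> oO; elim: n f g => [|n IH] f g fg /= [df Df]; split.
- move=> x Ox; apply: near_eq_differentiable (df x Ox).
  by apply: filterS (open_nbhs_nbhs (conj oO Ox)).
- by [].
- move=> x Ox; apply: near_eq_differentiable (df x Ox).
  by apply: filterS (open_nbhs_nbhs (conj oO Ox)).
- move=> v; apply: IH (Df v) => x Ox; apply: near_eq_derive.
  by apply: filterS (open_nbhs_nbhs (conj oO Ox)).
Qed.

Lemma smooth_on_ext W O (f g : V -> W) : open O -> (forall x, O x -> f x = g x) ->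
  smooth_on O f -> smooth_on O g.
Proof.
by move=> oO fg /smooth_onP sf; apply/smooth_onP => n; apply: smooth_order_ext (sf n).
Qed.

Lemma smooth_on_sub W O O' (f : V -> W) : O' `<=` O -> smooth_on O f ->
  smooth_on O' f.
Proof. by move=> OO' sf vs x /OO'; exact: sf. Qed.

Lemma smooth_on_local W O (f : V -> W) :
  (forall x, O x -> exists2 U, U x & smooth_on U f) -> smooth_on O f.
Proof. by move=> H vs x /H[U Ux]; exact. Qed.

Lemma smooth_on_cst W O (a : W) : smooth_on O (cst a : V -> W).
Proof.
apply/smooth_onP => n; elim: n a => [|n IH] a /=; split=> //.
move=> v; rewrite (_ : 'D_v _ = cst 0) //.
by apply/funext => x; rewrite derive_cst.
Qed.

Lemma smooth_order_cst W O (a : W) n : smooth_order n O (cst a : V -> W).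
Proof. by have /smooth_onP := @smooth_on_cst W O a; exact. Qed.

Lemma derive_D W (f g : V -> W) x v : differentiable f x -> differentiable g x ->
  'D_v (fun x => f x + g x) x = 'D_v f x + 'D_v g x.
Proof. by move=> df dg; rewrite -deriveD //; exact: diff_derivable. Qed.

Lemma derive_M (f g : V -> R) x v : differentiable f x -> differentiable g x ->
  'D_v (fun x => f x * g x) x = f x * 'D_v g x + g x * 'D_v f x.
Proof. by move=> df dg; rewrite -deriveM //; exact: diff_derivable. Qed.

Lemma derive_N W (f : V -> W) x v : differentiable f x ->
  'D_v (fun x => - f x) x = - 'D_v f x.
Proof. by move=> df; rewrite -deriveN //; exact: diff_derivable. Qed.

Lemma derive_B W (f g : V -> W) x v : differentiable f x -> differentiable g x ->
  'D_v (fun x => f x - g x) x = 'D_v f x - 'D_v g x.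
Proof. by move=> df dg; rewrite -deriveB //; exact: diff_derivable. Qed.

Lemma smooth_orderD W O (f g : V -> W) n : open O -> smooth_order n O f -> smooth_order n O g ->
  smooth_order n O (fun x => f x + g x).
Proof.
move=> oO; elim: n f g => [|n IH] f g /= [df Df] [dg Dg]; split=> //.
- by move=> x Ox; apply: differentiableD; [exact: df|exact: dg].
- by move=> x Ox; apply: differentiableD; [exact: df|exact: dg].
- move=> v; apply: smooth_order_ext (IH _ _ (Df v) (Dg v)) => // x Ox.
  by rewrite derive_D //; [exact: df|exact: dg].
Qed.

Lemma smooth_orderM O (f g : V -> R) n : open O -> smooth_order n O f -> smooth_order n O g ->
  smooth_order n O (fun x => f x * g x).
Proof.
move=> oO; elim: n f g => [|n IH] f g sf sg; have [df Df] := sf; have [dg Dg] := sg.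
  by split=> // x Ox; apply: differentiableM; [exact: df|exact: dg].
split=> [x Ox|v]; first by apply: differentiableM; [exact: df|exact: dg].
apply: (@smooth_order_ext _ _ (fun x => f x * 'D_v g x + g x * 'D_v f x)) => //.
  by move=> x Ox; rewrite derive_M //; [exact: df|exact: dg].
by apply: smooth_orderD => //; apply: IH; by [exact: smooth_orderW|exact: Df|exact: Dg].
Qed.

Lemma smooth_onD W O (f g : V -> W) : open O -> smooth_on O f -> smooth_on O g ->
  smooth_on O (fun x => f x + g x).
Proof.
by move=> oO /smooth_onP sf /smooth_onP sg; apply/smooth_onP => n; apply: smooth_orderD.
Qed.

Lemma smooth_onM O (f g : V -> R) : open O -> smooth_on O f -> smooth_on O g ->
  smooth_on O (fun x => f x * g x).
Proof.
by move=> oO /smooth_onP sf /smooth_onP sg; apply/smooth_onP => n; apply: smooth_orderM.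
Qed.

Lemma smooth_onN O (f : V -> R) : open O -> smooth_on O f ->
  smooth_on O (fun x => - f x).
Proof.
move=> oO sf; rewrite (_ : (fun x => - f x) = fun x => -1 * f x).
  by apply: smooth_onM => //; exact: smooth_on_cst.
by apply/funext => x; rewrite mulN1r.
Qed.

Lemma smooth_onB O (f g : V -> R) : open O -> smooth_on O f -> smooth_on O g ->
  smooth_on O (fun x => f x - g x).
Proof. by move=> oO sf sg; apply: smooth_onD => //; exact: smooth_onN. Qed.

Lemma smooth_onX O (f : V -> R) n : open O -> smooth_on O f ->
  smooth_on O (fun x => f x ^+ n).
Proof.
move=> oO sf; elim: n => [|n IH]; first exact: smooth_on_cst.
rewrite (_ : (fun x => _) = fun x => f x * f x ^+ n); first exact: smooth_onM.
by apply/funext => x; rewrite exprS.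
Qed.

Lemma smooth_on_sum W O (I : Type) (r : seq I) (P : pred I) (f : I -> V -> W) :
  open O -> (forall i, P i -> smooth_on O (f i)) ->
  smooth_on O (fun x => \sum_(i <- r | P i) f i x).
Proof.
move=> oO sf; elim: r => [|i r IH].
  by under eq_fun do rewrite big_nil; exact: smooth_on_cst.
case Pi: (P i); under eq_fun do rewrite big_cons Pi; last exact: IH.
by apply: smooth_onD => //; exact: sf.
Qed.

Lemma smooth_on_prod O (I : Type) (r : seq I) (P : pred I) (f : I -> V -> R) :
  open O -> (forall i, P i -> smooth_on O (f i)) ->
  smooth_on O (fun x => \prod_(i <- r | P i) f i x).
Proof.
move=> oO sf; elim: r => [|i r IH].
  by under eq_fun do rewrite big_nil; exact: smooth_on_cst.
case Pi: (P i); under eq_fun do rewrite big_cons Pi; last exact: IH.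
by apply: smooth_onM => //; exact: sf.
Qed.

Lemma smooth_onV O (f : V -> R) : open O -> smooth_on O f ->
  (forall x, O x -> f x != 0) -> smooth_on O (fun x => (f x)^-1).
Proof.
move=> oO /smooth_onP sf f0; apply/smooth_onP => n.
elim: n => [|n IH]; have dV : forall x, O x -> differentiable (fun x => (f x)^-1) x.
- by move=> x Ox; apply: differentiableV; [exact: (smooth_order_diff (sf 0%N))|exact: f0].
- by split.
- by move=> x Ox; apply: differentiableV; [exact: (smooth_order_diff (sf 0%N))|exact: f0].
split=> // v.
apply: (@smooth_order_ext _ _ (fun x => - 1 * ((f x)^-1 * (f x)^-1) * 'D_v f x)) => //.
  move=> x Ox; rewrite [RHS]deriveV ?f0 //.
    by rewrite -[RHS]/(- (f x ^+ 2)^-1 * 'D_v f x) expr2 invfM mulN1r.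
  by apply: diff_derivable; exact: (smooth_order_diff (sf 0%N)).
have Hc := @smooth_order_cst (R : normedModType R) O (-1) n.
apply: smooth_orderM => //; last by have [_] := sf n.+1; exact.
by apply: smooth_orderM => //; exact: smooth_orderM.
Qed.

End Smooth.

Section Affine.
Context {R : realType} {U V W : normedModType R}.
Variables (A : U -> V) (L : U -> V).
Hypothesis affA : forall h u x, A (h *: u + x) = h *: L u + A x.

(** The difference quotients themselves agree, so that nothing is assumed about
    [f]; in particular iterated derivatives of [f \o A] are those of [f]. *)
Lemma derive_affine (f : V -> W) u x : 'D_u (f \o A) x = 'D_(L u) f (A x).
Proof.
rewrite /derive.
set F := (X in X @ _).
rewrite (_ : F = fun h => h^-1 *: ((f \o shift (A x)) (h *: L u) - f (A x))) //.
by apply/funext => h; rewrite /F /= affA.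
Qed.

Lemma smooth_on_affine (O : set V) (f : V -> W) :
  (forall x, differentiable A x) -> smooth_on O f ->
  smooth_on (A @^-1` O) (f \o A).
Proof.
move=> dA sf vs x Ox.
have -> : iter_derive vs (f \o A) = iter_derive (map L vs) f \o A.
  elim: vs => //= v vs ->; apply/funext => y.
  exact: (@derive_affine (iter_derive (map L vs) f)).
by apply: differentiable_comp; [exact: dA|exact: sf].
Qed.

End Affine.

Section Components.
Context {R : realType} {V : normedModType R} {n : nat}.
Implicit Types (O : set V) (c : V -> 'rV[R]_n).

Lemma rV_sum_delta (v : 'rV[R]_n) : v = \sum_(k < n) v 0 k *: delta_mx 0 k.
Proof. by rewrite [LHS]matrix_sum_delta big_ord1. Qed.

Lemma differentiable_entry c x k :
  differentiable c x -> differentiable (fun x => c x 0 k) x.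
Proof.
move=> dc; apply: (@differentiable_comp _ _ _ _ c (fun N => N 0 k)) => //.
exact: differentiable_coord.
Qed.

Lemma derive_entry c x v k : differentiable c x ->
  ('D_v c x) 0 k = 'D_v (fun x => c x 0 k) x.
Proof. by move=> dc; rewrite derive_mx ?mxE //; exact: diff_derivable. Qed.

Lemma smooth_order_entry m O c k : open O -> smooth_order m O c ->
  smooth_order m O (fun x => c x 0 k).
Proof.
move=> oO; elim: m c => [|m IH] c /= [dc Dc]; split=> //.
- by move=> x Ox; apply: differentiable_entry; exact: dc.
- by move=> x Ox; apply: differentiable_entry; exact: dc.
- move=> v; apply: smooth_order_ext (IH _ (Dc v)) => // x Ox.
  by rewrite derive_entry //; exact: dc.
Qed.

Lemma smooth_on_entry O c k : open O -> smooth_on O c ->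
  smooth_on O (fun x => c x 0 k).
Proof.
by move=> oO /smooth_onP sc; apply/smooth_onP => m; exact: smooth_order_entry.
Qed.

Lemma derive_sum_delta (W : normedModType R) (f : 'rV[R]_n -> W) y v :
  differentiable f y -> 'D_v f y = \sum_(k < n) v 0 k *: 'D_(delta_mx 0 k) f y.
Proof.
move=> df; rewrite deriveE // {1}(rV_sum_delta v) linear_sum.
by apply: eq_bigr => k _; rewrite linearZ /= deriveE.
Qed.

End Components.

Section Composition.
Context {R : realType}.

Lemma derive_comp (U V W : normedModType R) (c : U -> V) (f : V -> W) x v :
  differentiable c x -> differentiable f (c x) ->
  'D_v (f \o c) x = 'D_('D_v c x) f (c x).
Proof.
move=> dc df; rewrite deriveE; last exact: differentiable_comp.
by rewrite diff_comp //= !deriveE.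
Qed.

Lemma derive_linear (V W : normedModType R) (f : V -> W) x a v w :
  differentiable f x -> 'D_(a *: v + w) f x = a *: 'D_v f x + 'D_w f x.
Proof. by move=> df; rewrite !deriveE // linearP. Qed.

Lemma smooth_order_sum (V : normedModType R) m (O : set V) (I : Type) (r : seq I)
    (f : I -> V -> R) :
  open O -> (forall i, smooth_order m O (f i)) ->
  smooth_order m O (fun x => \sum_(i <- r) f i x).
Proof.
move=> oO sf; elim: r => [|i r IH].
  by under eq_fun do rewrite big_nil; exact: smooth_order_cst.
by under eq_fun do rewrite big_cons; apply: smooth_orderD.
Qed.


(** By the chain rule a derivative of [f \o c] is a sum of products of a
    derivative of [c] with the composite of a partial derivative of [f] and [c],
    to which the induction hypothesis applies. *)
Lemma smooth_order_comp (V : normedModType R) n m (O : set V) (O' : set 'rV[R]_n)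
    (c : V -> 'rV[R]_n) (f : 'rV[R]_n -> R) :
  open O -> (forall x, O x -> O' (c x)) -> smooth_order m O c -> smooth_order m O' f ->
  smooth_order m O (f \o c).
Proof.
move=> oO cO; elim: m f => [|m IH] f sc sf.
  split=> // x Ox; apply: differentiable_comp; first exact: smooth_order_diff sc Ox.
  by apply: (smooth_order_diff sf); exact: cO.
have dc x : O x -> differentiable c x by exact: (smooth_order_diff sc).
have df x : O x -> differentiable f (c x) by move=> /cO; exact: (smooth_order_diff sf).
split=> [x Ox|v]; first by apply: differentiable_comp; [exact: dc|exact: df].
apply: (@smooth_order_ext _ _ _ _
  (fun x => \sum_(k < n) ('D_v c x) 0 k * ('D_(delta_mx 0 k) f \o c) x)) => //.
  move=> x Ox; rewrite [RHS]derive_comp; [|exact: dc|exact: df].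
  by rewrite derive_sum_delta //; exact: df.
apply: smooth_order_sum => // k; apply: smooth_orderM => //.
  by apply: smooth_order_entry => //; exact: smooth_orderS.
by apply: IH; [exact: smooth_orderW|exact: smooth_orderS].
Qed.

Lemma smooth_on_comp (V : normedModType R) n (O : set V) (O' : set 'rV[R]_n)
    (c : V -> 'rV[R]_n) (f : 'rV[R]_n -> R) :
  open O -> (forall x, O x -> O' (c x)) -> smooth_on O c -> smooth_on O' f ->
  smooth_on O (f \o c).
Proof.
move=> oO cO /smooth_onP sc /smooth_onP sf; apply/smooth_onP => m.
exact: smooth_order_comp (sc m) (sf m).
Qed.

End Composition.

Section Schwarz.
Context {R : realType} {V : normedModType R}.

Lemma MVT_line (f : V -> R) (x v : V) (h : R) : 0 < h ->
  (forall t, 0 <= t <= h -> differentiable f (t *: v + x)) ->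
  exists2 t, 0 < t < h & f (h *: v + x) - f x = h * 'D_v f (t *: v + x).
Proof.
move=> h0 df.
have aff : forall k (u t : R), (k *: u + t) *: v + x = k *: (u *: v) + (t *: v + x).
  by move=> k u t; rewrite scalerDl scalerA addrA.
have E t : 0 <= t <= h ->
    is_derive t 1 (fun s : R => f (s *: v + x)) ('D_v f (t *: v + x)).
  move=> th; apply: DeriveDef.
    apply/derivable1_diffP; apply: (@differentiable_comp _ _ _ _ (fun s : R => s *: v + x) f).
      apply: differentiableD; last exact: differentiable_cst.
      exact: differentiableZl.
    exact: df.
  by rewrite (@derive_affine _ _ _ _ (fun s : R => s *: v + x) _ aff) scale1r.
have [|||t] := @MVT R (fun s => f (s *: v + x)) (fun t => 'D_v f (t *: v + x)) 0 h.
- exact: h0.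
- by move=> t; rewrite in_itv /= => /andP[t0 th]; apply: E; rewrite !ltW.
- apply: derivable_within_continuous => t; rewrite in_itv /= => th.
  by have [] := E t th.
rewrite in_itv /= => th; rewrite scale0r add0r subr0 mulrC => ?.
by exists t.
Qed.

(** The mean value theorem is used twice: in the direction [v] for the
    difference of [f] in the direction [w], then in the direction [w] for the
    derivative of [f] along [v]. *)
Lemma second_difference (f : V -> R) (O : set V) (x v w : V) (h : R) : 0 < h ->
  (forall s t, 0 <= s <= h -> 0 <= t <= h -> O (s *: v + (t *: w + x))) ->
  smooth_on O f ->
  exists s t, [/\ 0 < s < h, 0 < t < h &
    f (h *: v + (h *: w + x)) - f (h *: v + x) - (f (h *: w + x) - f x) =
    h * (h * 'D_w ('D_v f) (s *: v + (t *: w + x)))].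
Proof.
move=> h0 HO sf.
have h00 : 0 <= (0 : R) <= h by rewrite lexx ltW.
have hh : 0 <= h <= h by rewrite lexx ltW.
pose g y := f (h *: w + y) - f y.
have aff : forall k u y, h *: w + (k *: u + y) = k *: (u : V) + (h *: w + y).
  by move=> k u y; rewrite addrCA.
have dsh y : differentiable (fun y : V => h *: w + y) y.
  by apply: differentiableD; [exact: differentiable_cst|].
have HO0 s : 0 <= s <= h -> O (s *: v + x).
  by move=> sh; have := HO s 0 sh h00; rewrite scale0r add0r.
have df y : O y -> differentiable f y by exact: smooth_on_differentiable.
have dfw s : 0 <= s <= h -> differentiable (fun y => f (h *: w + y)) (s *: v + x).
  move=> sh; apply: (@differentiable_comp _ _ _ _ (fun y => h *: w + y) f) => //.
  by apply: df; rewrite addrCA; exact: HO.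
have [s sh Es] : exists2 s, 0 < s < h &
    g (h *: v + x) - g x = h * 'D_v g (s *: v + x).
  by apply: MVT_line => // s sh; apply: differentiableB; [exact: dfw|apply/df/HO0].
have sh' : 0 <= s <= h by case/andP: sh => ? ?; rewrite !ltW.
have Dg : 'D_v g (s *: v + x) =
    'D_v f (h *: w + (s *: v + x)) - 'D_v f (s *: v + x).
  rewrite derive_B; [|exact: dfw|exact/df/HO0].
  by rewrite -(@derive_affine _ _ _ _ (fun y => h *: w + y) id aff).
have [t th Et] : exists2 t, 0 < t < h &
    'D_v f (h *: w + (s *: v + x)) - 'D_v f (s *: v + x) =
    h * 'D_w ('D_v f) (t *: w + (s *: v + x)).
  apply: (@MVT_line ('D_v f) (s *: v + x) w h h0) => t th.
  have /smooth_on_differentiable := smooth_on_derive v sf; apply.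
  by rewrite addrCA; exact: HO.
exists s, t; split=> //.
rewrite (addrCA (s *: v)) -Et -Dg -Es /g.
by rewrite (addrCA (h *: w)).
Qed.

(** The second difference is symmetric in [v] and [w], so [second_difference]
    finds, arbitrarily close to [x], two points at which the two mixed
    derivatives agree; both are continuous at [x]. *)
Lemma derive_swap (O : set V) (f : V -> R) (x v w : V) : open O -> O x ->
  smooth_on O f -> 'D_v ('D_w f) x = 'D_w ('D_v f) x.
Proof.
move=> oO Ox sf; apply/eqP; rewrite -subr_eq0 -normr_le0.
apply/ler_addgt0Pl => e e0; rewrite addr0.
have cont a b : {for x, continuous ('D_a ('D_b f))}.
  apply: differentiable_continuous.
  by have /(smooth_on_derive a)/smooth_on_differentiable := smooth_on_derive b sf; exact.
have e20 : 0 < e / 2 by rewrite divr_gt0.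
have N1 := open_nbhs_nbhs (conj oO Ox).
have /cvgrPdist_le /(_ _ e20) N2 := cont v w.
have /cvgrPdist_le /(_ _ e20) N3 := cont w v.
have N := filterI N1 (filterI N2 N3).
have [d /= d0 dN] := (nbhs_ballP _ _).1 (N _ _).
(* With sides [d / K] the whole parallelogram lies in the ball of radius [d]. *)
pose K := `|v| + `|w| + 1.
have K0 : 0 < K by rewrite /K ltr_wpDl // addr_ge0.
pose h := d / K.
have h0 : 0 < h by rewrite divr_gt0.
have near_x s t : 0 <= s <= h -> 0 <= t <= h -> ball x d (s *: v + (t *: w + x)).
  move=> /andP[s0 sh] /andP[t0 th]; rewrite -ball_normE /ball_ /=.
  rewrite addrA opprD addrCA subrr addr0 normrN.
  apply: (le_lt_trans (ler_normD _ _)); rewrite !normrZ !ger0_norm //.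
  have -> : d = h * `|v| + h * `|w| + h.
    by rewrite -!mulrDr -[X in _ + X]mulr1 -mulrDr -/K /h divfK // gt_eqF.
  by rewrite ltr_pwDr // lerD // ler_wpM2r.
clearbody h; clear N N1 N2 N3 K K0.
have HO s t sh th := (dN _ (near_x s t sh th)).1.
have near_x' s t : 0 <= s <= h -> 0 <= t <= h -> ball x d (s *: w + (t *: v + x)).
  by move=> sh th; rewrite addrCA; exact: near_x.
have HO' s t sh th := (dN _ (near_x' s t sh th)).1.
have [s [t [/andP[s0 sh] /andP[t0 th] E1]]] := second_difference h0 HO sf.
have [s' [t' [/andP[s0' sh'] /andP[t0' th'] E2]]] := second_difference h0 HO' sf.
have sth : 0 <= s <= h by rewrite !ltW.
have tth : 0 <= t <= h by rewrite !ltW.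
have sth' : 0 <= s' <= h by rewrite !ltW.
have tth' : 0 <= t' <= h by rewrite !ltW.
have [_ [_ /= C1]] := dN _ (near_x s t sth tth).
have [_ [/= C2 _]] := dN _ (near_x' s' t' sth' tth').
have E3 : 'D_w ('D_v f) (s *: v + (t *: w + x)) =
    'D_v ('D_w f) (s' *: w + (t' *: v + x)).
  apply: (mulfI (lt0r_neq0 h0)); apply: (mulfI (lt0r_neq0 h0)).
  move: E1 E2; rewrite (addrCA (h *: w) (h *: v) x).
  move: (f (h *: v + (h *: w + x))) (f (h *: v + x)) (f (h *: w + x)) (f x).
  move: ('D_w ('D_v f) _) ('D_v ('D_w f) _) => p q a b c d' <- <-.
  by rewrite !opprB addrACA [RHS]addrACA (addrC (- b)).
rewrite -E3 in C2.
move: C1 C2; move: ('D_w ('D_v f) (s *: v + (t *: w + x))).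
move: ('D_w ('D_v f) x) ('D_v ('D_w f) x) => p q r C1 C2.
rewrite [leRHS]splitr -(subrKA r); apply: (le_trans (ler_normD _ _)).
by apply: lerD; [exact: C2|rewrite distrC; exact: C1].
Qed.

End Schwarz.

(** * Charts and pull-backs of forms *)

Section Charts.
Context {R : realType} {n : nat} {M : manifold R n}.

Lemma cdom_par (i : chart M) y : cim i y -> cdom i (par i y).
Proof. by case=> x xi <-; rewrite coordK. Qed.

Lemma coord_par (i : chart M) y : cim i y -> coord i (par i y) = y.
Proof. by case=> x xi <-; rewrite coordK. Qed.

Lemma cim_coord (i : chart M) x : cdom i x -> cim i (coord i x).
Proof. by exists x. Qed.

Lemma smooth_transition (i j : chart M) y : cim i y -> cdom j (par i y) ->
  differentiable (coord j \o par i) y.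
Proof.
move=> iy jy; apply: smooth_on_differentiable (@chart_smooth _ _ M i j) _.
by exists (par i y); rewrite ?coord_par //; split=> //; exact: cdom_par.
Qed.

Lemma smooth_map_par (i : chart M) : smooth_map (cim i) (par i).
Proof.
split=> [y iy|j]; first exact: par_continuous.
apply: smooth_on_sub (@chart_smooth _ _ M i j) => y [iy jy].
by exists (par i y); rewrite ?coord_par //; split=> //; exact: cdom_par.
Qed.

(** As for all tangent vectors, [v] consists of coordinates in the preferred
    chart at [u]. *)
Definition dfun (g : M -> R) (u : M) (v : 'rV[R]_n) : R :=
  'D_v (g \o par (chart_at u)) (coord (chart_at u) u).

Lemma cim_at (u : M) : cim (chart_at u) (coord (chart_at u) u).
Proof. exact/cim_coord/chart_atP. Qed.

End Charts.

Section PullBack.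
Context {R : realType} {n : nat} {M : manifold R n} {V : normedModType R}.
Variables (O : set V) (c : V -> M).
Hypotheses (oO : open O) (sc : smooth_map O c).

Lemma smooth_map_open (i : chart M) : open (O `&` c @^-1` cdom i).
Proof.
rewrite openE => x [Ox cx]; apply: filterI; first exact: open_nbhs_nbhs.
have [cc _] := sc; apply: (cc x Ox).
by apply: open_nbhs_nbhs; split => //; exact: cdom_open.
Qed.

Lemma smooth_map_near (i : chart M) x : O x -> cdom i (c x) ->
  \forall y \near x, O y /\ cdom i (c y).
Proof.
move=> Ox cx; apply: open_nbhs_nbhs; split; first exact: smooth_map_open i.
by [].
Qed.

Lemma smooth_coord (i : chart M) :
  smooth_on (O `&` c @^-1` cdom i) (coord i \o c).
Proof. by have [_] := sc; exact. Qed.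

Lemma differentiable_coord_map (i : chart M) x : O x -> cdom i (c x) ->
  differentiable (coord i \o c) x.
Proof. by move=> Ox cx; apply: smooth_on_differentiable (@smooth_coord i) _. Qed.

Lemma derive_chart (i : chart M) (W : normedModType R) (f : M -> W) x v :
  O x -> cdom i (c x) -> differentiable (f \o par i) (coord i (c x)) ->
  'D_v (f \o c) x = 'D_('D_v (coord i \o c) x) (f \o par i) (coord i (c x)).
Proof.
move=> Ox cx df.
rewrite (_ : 'D_v (f \o c) x = 'D_v ((f \o par i) \o (coord i \o c)) x).
  by rewrite derive_comp //; exact: differentiable_coord_map.
apply: near_eq_derive; apply: filterS (smooth_map_near Ox cx) => y [Oy cy] /=.
by rewrite coordK.
Qed.

(** The preferred chart at [c x] varies with [x], hence [tder c x v] is not the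
    derivative of one fixed map; in a fixed chart [i] it is the image of the
    derivative of the coordinates of [c] under the parametrization [par i]. *)
Lemma tder_chart (i : chart M) x v : O x -> cdom i (c x) ->
  tder c x v = tder (par i) (coord i (c x)) ('D_v (coord i \o c) x).
Proof.
move=> Ox cx; rewrite /tder (coordK cx).
apply: (@derive_chart i _ (coord (chart_at (c x)))) => //.
apply: smooth_transition; first exact: cim_coord.
by rewrite coordK //; exact: chart_atP.
Qed.

Lemma smooth_comp_fun (g : M -> R) : smooth_fun g -> smooth_on O (g \o c).
Proof.
move=> sg; apply: smooth_on_local => x Ox.
set i := chart_at (c x); exists (O `&` c @^-1` cdom i).
  by split=> //; exact: chart_atP.
apply: (@smooth_on_ext _ _ _ _ ((g \o par i) \o (coord i \o c))).
- exact: smooth_map_open.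
- by move=> y [Oy cy] /=; rewrite coordK.
apply: smooth_on_comp (sg i); [exact: smooth_map_open| |exact: smooth_coord].
by move=> y [Oy cy]; exact: cim_coord.
Qed.

Lemma derive_comp_fun (g : M -> R) x v : smooth_fun g -> O x ->
  'D_v (g \o c) x = dfun g (c x) (tder c x v).
Proof.
move=> sg Ox; rewrite (@derive_chart (chart_at (c x))) //; first exact: chart_atP.
by apply: smooth_on_differentiable (sg _) _; exact: cim_at.
Qed.

End PullBack.

Section Forms.
Context {R : realType} {n : nat} {M : manifold R n}.
Implicit Types (a : form1 M).

Lemma ap_linear a (u : M) k v w : ap a u (k *: v + w) = k * ap a u v + ap a u w.
Proof. by rewrite /ap mulmxDl -scalemxAl !mxE. Qed.

Lemma ap_sum a (u : M) (I : Type) (r : seq I) (F : I -> 'rV[R]_n) :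
  ap a u (\sum_(i <- r) F i) = \sum_(i <- r) ap a u (F i).
Proof. by rewrite /ap mulmx_suml summxE. Qed.

Lemma apZ a (u : M) k v : ap a u (k *: v) = k * ap a u v.
Proof. by rewrite /ap -scalemxAl !mxE. Qed.

Lemma form_in_sum (i : chart M) a w y : cim i y ->
  form_in i a w y = \sum_(k < n) w 0 k * form_in i a (delta_mx 0 k) y.
Proof.
move=> iy; rewrite /form_in {1}/tder derive_sum_delta.
  by rewrite ap_sum; apply: eq_bigr => k _; rewrite apZ.
by apply: smooth_transition => //; exact: chart_atP.
Qed.

(** The pull-back of [a] by [c], with the constant vector [v] as first argument
    so that [pull c a v] is a function on [V] that can be differentiated. *)
Definition pull (V : normedModType R) (c : V -> M) a (v x : V) : R :=
  ap a (c x) (tder c x v).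

Section PullForm.
Context {V : normedModType R}.
Variables (O : set V) (c : V -> M).
Hypotheses (oO : open O) (sc : smooth_map O c).

Lemma pullE (i : chart M) a v x : O x -> cdom i (c x) ->
  pull c a v x = \sum_(k < n) 'D_v (fun y => coord i (c y) 0 k) x *
                  form_in i a (delta_mx 0 k) (coord i (c x)).
Proof.
move=> Ox cx; rewrite /pull (tder_chart oO sc v Ox cx).
transitivity (form_in i a ('D_v (coord i \o c) x) (coord i (c x))).
  by rewrite /form_in coordK.
rewrite form_in_sum; last exact: cim_coord.
apply: eq_bigr => k _; congr (_ * _); rewrite derive_entry //.
exact: (differentiable_coord_map sc Ox cx).
Qed.

Lemma smooth_coord_entry (i : chart M) k :
  smooth_on (O `&` c @^-1` cdom i) (fun y => coord i (c y) 0 k).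
Proof.
apply: (@smooth_on_entry _ _ _ _ (coord i \o c)); last exact: smooth_coord.
exact: smooth_map_open.
Qed.

Lemma smooth_form_comp (i : chart M) a k : smooth_form a ->
  smooth_on (O `&` c @^-1` cdom i)
    (fun y => form_in i a (delta_mx 0 k) (coord i (c y))).
Proof.
move=> sa; apply: (smooth_on_comp _ _ (@smooth_coord _ _ _ _ _ _ sc i) (sa i (delta_mx 0 k))).
  exact: smooth_map_open.
by move=> y [Oy cy]; exact: cim_coord.
Qed.

Lemma smooth_pull a v : smooth_form a -> smooth_on O (pull c a v).
Proof.
move=> sa; apply: smooth_on_local => x Ox.
set i := chart_at (c x); exists (O `&` c @^-1` cdom i).
  by split=> //; exact: chart_atP.
have oU := smooth_map_open oO sc i.
apply: (@smooth_on_ext _ _ _ _ (fun y => \sum_(k < n)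
   'D_v (fun y => coord i (c y) 0 k) y * form_in i a (delta_mx 0 k) (coord i (c y)))).
- by [].
- by move=> y [Oy cy]; rewrite (@pullE i).
apply: smooth_on_sum => // k _; apply: smooth_onM => //.
  exact/smooth_on_derive/smooth_coord_entry.
exact: smooth_form_comp.
Qed.

(** In coordinates a pull-back is a sum of [dg_k * f_k]; antisymmetrizing its
    derivative cancels the second derivatives of the coordinates [g_k], by
    [derive_swap]. *)
Lemma extd_pull a v w x : smooth_form a -> O x ->
  'D_v (pull c a w) x - 'D_w (pull c a v) x =
  extd a (c x) (tder c x v) (tder c x w).
Proof.
move=> sa Ox.
set i := chart_at (c x).
have cx : cdom i (c x) by exact: chart_atP.
have oU := smooth_map_open oO sc i.
have Ux : (O `&` c @^-1` cdom i) x by [].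
pose F k y := form_in i a (delta_mx 0 k) y.
pose f k y := F k (coord i (c y)).
pose g k y := coord i (c y) 0 k.
have sg k : smooth_on (O `&` c @^-1` cdom i) (g k) by exact: smooth_coord_entry.
have sf k : smooth_on (O `&` c @^-1` cdom i) (f k) by exact: smooth_form_comp.
have dc : differentiable (coord i \o c) x by exact: (differentiable_coord_map sc Ox cx).
have dF k : differentiable (F k) (coord i (c x)).
  by apply: smooth_on_differentiable (sa i _) _; exact: cim_coord.
have E1 p q : 'D_p (pull c a q) x =
    \sum_(k < n) ('D_q (g k) x * 'D_p (f k) x + f k x * 'D_p ('D_q (g k)) x).
  transitivity ('D_p (fun y => \sum_(k < n) 'D_q (g k) y * f k y) x).
    apply: near_eq_derive; apply: filterS (smooth_map_near oO sc Ox cx) => y [Oy cy].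
    exact: pullE.
  have Dd k : derivable (fun y => 'D_q (g k) y * f k y) x p.
    apply: diff_derivable; apply: differentiableM.
      by apply: smooth_on_differentiable (smooth_on_derive q (sg k)) Ux.
    exact: smooth_on_differentiable (sf k) Ux.
  rewrite (_ : (fun y => _) = \sum_(k < n) (fun y => 'D_q (g k) y * f k y)).
    rewrite derive_sum //; apply: eq_bigr => k _; rewrite derive_M //.
      by apply: smooth_on_differentiable (smooth_on_derive q (sg k)) Ux.
    exact: smooth_on_differentiable (sf k) Ux.
  by apply/funext => y; rewrite fct_sumE.
have E2 p q : 'D_(tder c x p) (form_in i a (tder c x q)) (coord i (c x)) =
    \sum_(k < n) 'D_q (g k) x * 'D_p (f k) x.
  transitivity ('D_(tder c x p) (fun y => \sum_(k < n) tder c x q 0 k * F k y)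
      (coord i (c x))).
    apply: near_eq_derive.
    have : open_nbhs (coord i (c x)) (cim i) by split; [exact: cim_open|exact: cim_coord].
    by move=> /open_nbhs_nbhs; apply: filterS => y iy; exact: form_in_sum.
  rewrite (_ : (fun y => _) = \sum_(k < n) (fun y => tder c x q 0 k * F k y)).
    rewrite derive_sum; last first.
      move=> k; apply: diff_derivable; apply: differentiableM => //.
    apply: eq_bigr => k _; rewrite derive_M; [|exact: differentiable_cst|exact: dF].
    rewrite derive_cst mulr0 addr0 /tder (derive_entry _ _ dc).
    by congr (_ * _); rewrite -(derive_comp _ dc (dF k)).
  by apply/funext => y; rewrite fct_sumE.
have -> : extd a (c x) (tder c x v) (tder c x w) =
    \sum_(k < n) 'D_w (g k) x * 'D_v (f k) x - \sum_(k < n) 'D_v (g k) x * 'D_w (f k) x.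
  by congr (_ - _); exact: E2.
rewrite (E1 v w) (E1 w v) -!sumrB; apply: eq_bigr => k _.
by rewrite (derive_swap v w oU Ux (sg k)) opprD addrACA subrr addr0.
Qed.

End PullForm.
End Forms.

Section SmoothBetween.
Context {R : realType} {m n : nat} {M : manifold R m} {N : manifold R n}.
Variable f : M -> N.
Hypothesis sf : forall i : chart M, smooth_map (cim i) (f \o par i).

Lemma differentiable_between u :
  differentiable (coord (chart_at (f u)) \o f \o par (chart_at u))
    (coord (chart_at u) u).
Proof.
have [_ /(_ (chart_at (f u)))] := sf (chart_at u).
move=> /smooth_on_differentiable; apply; split; first exact: cim_at.
by rewrite /= coordK; exact: chart_atP.
Qed.

Lemma tdiffE u v : tdiff f u v =
  'D_v (coord (chart_at (f u)) \o f \o par (chart_at u)) (coord (chart_at u) u).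
Proof. by rewrite /tdiff /tder /= coordK //; exact: chart_atP. Qed.

Lemma tdiff_linear u a v w :
  tdiff f u (a *: v + w) = a *: tdiff f u v + tdiff f u w.
Proof. by rewrite !tdiffE derive_linear //; exact: differentiable_between. Qed.

Lemma tder_comp (V : normedModType R) (O : set V) (c : V -> M) x v :
  open O -> smooth_map O c -> O x ->
  tder (f \o c) x v = tdiff f (c x) (tder c x v).
Proof.
move=> oO sc Ox; rewrite tdiffE /tder.
apply: (@derive_chart _ _ _ _ O c oO sc (chart_at (c x)) _ (coord (chart_at (f (c x))) \o f)) => //.
  exact: chart_atP.
exact: differentiable_between.
Qed.

End SmoothBetween.

(** * Coframes and the identities d(d eta) = 0 *)

Section SecondExterior.
Context {R : realType} {V : normedModType R}.
Variables (O : set V) (oO : open O).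
Implicit Types (a b : V -> V -> R) (g : V -> R).

(** The exterior derivative on the flat space [V], where a one-form is a
    function of a constant vector and of the point, such as [pull c a]. *)
Definition dflat a (v w x : V) : R := 'D_v (a w) x - 'D_w (a v) x.

Definition wflat a b (v w x : V) : R := a v x * b w x - a w x * b v x.

(** The value on [(u, v, w)] of [d (g a /\ b)], expanded as
    [dg /\ a /\ b + g (da /\ b - a /\ db)]. *)
Definition dterm (t : (V -> R) * (V -> V -> R) * (V -> V -> R)) (u v w x : V) : R :=
  let: (g, a, b) := t in
  'D_u g x * wflat a b v w x + 'D_v g x * wflat a b w u x + 'D_w g x * wflat a b u v x
  + g x * (dflat a u v x * b w x + dflat a v w x * b u x + dflat a w u x * b v x
           - a u x * dflat b v w x - a v x * dflat b w u x - a w x * dflat b u v x).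

Definition tsum (s : seq ((V -> R) * (V -> V -> R) * (V -> V -> R))) (v w x : V) : R :=
  \sum_(t <- s) t.1.1 x * wflat t.1.2 t.2 v w x.

Lemma d_dflat a u v w x : (forall v, smooth_on O (a v)) -> O x ->
  'D_u (dflat a v w) x + 'D_v (dflat a w u) x + 'D_w (dflat a u v) x = 0.
Proof.
move=> sa Ox.
have da p q : differentiable ('D_p (a q)) x.
  exact: smooth_on_differentiable (smooth_on_derive p (sa q)) Ox.
rewrite /dflat !derive_B //.
have alg (x1 x2 x3 y1 y2 y3 : R) :
    y1 = x1 -> y2 = x2 -> y3 = x3 -> x1 - x2 + (x3 - y1) + (y2 - y3) = 0.
  by move=> -> -> ->; ring.
exact: (alg _ _ _ _ _ _ (derive_swap v u oO Ox (sa w))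
  (derive_swap w u oO Ox (sa v)) (derive_swap w v oO Ox (sa u))).
Qed.

Lemma derive_tsum s u v w x : O x ->
  (forall i, (i < size s)%N -> let t := nth (cst 0, fun _ => cst 0, fun _ => cst 0) s i in
     [/\ smooth_on O t.1.1, forall v, smooth_on O (t.1.2 v) & forall v, smooth_on O (t.2 v)]) ->
  'D_u (tsum s v w) x = \sum_(t <- s) (
    'D_u t.1.1 x * wflat t.1.2 t.2 v w x +
    t.1.1 x * ('D_u (t.1.2 v) x * t.2 w x + t.1.2 v x * 'D_u (t.2 w) x
             - 'D_u (t.1.2 w) x * t.2 v x - t.1.2 w x * 'D_u (t.2 v) x)) /\
  differentiable (tsum s v w) x.
Proof.
move=> Ox; elim: s => [|[[g a] b] s IH] Hs.
  rewrite /tsum big_nil (_ : (fun x => _) = cst 0); last first.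
    by apply/funext => y; rewrite big_nil.
  by split; [rewrite derive_cst|exact: differentiable_cst].
have [] := IH (fun i => Hs i.+1); move=> {}IH dIH.
have [/= sg sa sb] := Hs 0%N isT.
have dg := smooth_on_differentiable sg Ox.
have da v' := smooth_on_differentiable (sa v') Ox.
have db v' := smooth_on_differentiable (sb v') Ox.
have dm p q : differentiable (fun y => a p y * b q y) x by apply: differentiableM.
have dw : differentiable (wflat a b v w) x.
  by apply: (@differentiableB _ _ _ (fun y => a v y * b w y) (fun y => a w y * b v y)).
have dgw : differentiable (fun y => g y * wflat a b v w y) x by apply: differentiableM.
have E : tsum ((g, a, b) :: s) v w = (fun y => g y * wflat a b v w y + tsum s v w y).
  by apply/funext => y; rewrite /tsum big_cons.
rewrite E; split; last exact: differentiableD.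
rewrite derive_D // IH big_cons /=; congr (_ + _).
rewrite derive_M // /wflat derive_B // !derive_M //; ring.
Qed.

(** This is [d (d a) = 0].  The right-hand side of a structure equation is a
    combination of wedge products, and [dterm] differentiates each of them in a
    form in which the exterior derivatives of the factors can be substituted
    from the structure equations again. *)
Lemma bianchi a s u v w x : O x -> (forall v, smooth_on O (a v)) ->
  (forall i, (i < size s)%N -> let t := nth (cst 0, fun _ => cst 0, fun _ => cst 0) s i in
     [/\ smooth_on O t.1.1, forall v, smooth_on O (t.1.2 v) & forall v, smooth_on O (t.2 v)]) ->
  (forall v w x, O x -> dflat a v w x = tsum s v w x) ->
  \sum_(t <- s) dterm t u v w x = 0.
Proof.
move=> Ox sa ss E.
have E' p q r : 'D_p (dflat a q r) x = 'D_p (tsum s q r) x.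
  apply: near_eq_derive.
  by apply: filterS (open_nbhs_nbhs (conj oO Ox)) => y Oy; exact: E.
have := d_dflat u v w sa Ox; rewrite !E' !(derive_tsum _ _ _ Ox ss).1 -!big_split /=.
move=> H; rewrite -[RHS]H; apply: eq_bigr => -[[g b] c] _ /=; rewrite /dflat /wflat.
move: ('D_u g x) ('D_v g x) ('D_w g x) (g x).
move: ('D_u (b v) x) ('D_u (b w) x) ('D_v (b u) x) ('D_v (b w) x) ('D_w (b u) x) ('D_w (b v) x).
move: ('D_u (c v) x) ('D_u (c w) x) ('D_v (c u) x) ('D_v (c w) x) ('D_w (c u) x) ('D_w (c v) x).
move: (b u x) (b v x) (b w x) (c u x) (c v x) (c w x) => *; ring.
Qed.

End SecondExterior.

Section Frame.
Context {R : realType} {M : manifold R 4}.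
Variable C : coframe M.

Definition cof (k : nat) : form1 M :=
  match k with 0 => eta1 C | 1 => eta2 C | 2 => eta3 C | _ => phi C end.

Definition cof_mx (u : M) : 'M[R]_4 := \matrix_(k, j) cof j u k 0.

Definition dual (j : 'I_4) (u : M) : 'rV[R]_4 := row j (invmx (cof_mx u)).

Definition frame_der (j : 'I_4) (g : M -> R) (u : M) : R := dfun g u (dual j u).

Hypothesis Cf : coframing C.

Lemma cof_smooth k : smooth_form (cof k).
Proof. by have [[s1 s2 s3 s4] _] := Cf; case: k => [|[|[|k]]]. Qed.

Lemma cof_mulmx u v (j : 'I_4) : (v *m cof_mx u) 0 j = ap (cof j) u v.
Proof. by rewrite /ap !mxE; apply: eq_bigr => k _; rewrite mxE. Qed.

Lemma cof_inj u v : (forall j : 'I_4, ap (cof j) u v = 0) -> v = 0.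
Proof.
move=> H; apply: (coframing_free Cf (u := u)).
- by have := H (@Ordinal 4 0 isT).
- by have := H (@Ordinal 4 1 isT).
- by have := H (@Ordinal 4 2 isT).
- by have := H (@Ordinal 4 3 isT).
Qed.

Lemma cof_eq u v w : (forall j : 'I_4, ap (cof j) u v = ap (cof j) u w) -> v = w.
Proof.
move=> H; apply/eqP; rewrite -subr_eq0; apply/eqP; apply: (@cof_inj u) => j.
by rewrite addrC -scaleN1r ap_linear H mulN1r addNr.
Qed.

Lemma mx_unit_ker (A : 'M[R]_4) : (forall v : 'rV_4, v *m A = 0 -> v = 0) -> A \in unitmx.
Proof.
move=> H; rewrite -row_free_unit -kermx_eq0; apply/eqP/row_matrixP => i.
by rewrite row0; apply: H; rewrite -row_mul mulmx_ker row0.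
Qed.

Lemma cof_mx_unit u : cof_mx u \in unitmx.
Proof.
apply: mx_unit_ker => v v0; apply: (@cof_inj u) => j.
by rewrite -cof_mulmx v0 mxE.
Qed.

Lemma ap_dual u (i j : 'I_4) : ap (cof i) u (dual j u) = (i == j)%:R.
Proof.
rewrite -cof_mulmx /dual -row_mul mulVmx; last exact: cof_mx_unit.
by rewrite !mxE eq_sym.
Qed.

Lemma dual_sum u v : v = \sum_(j < 4) ap (cof j) u v *: dual j u.
Proof.
apply: (@cof_eq u) => i; rewrite ap_sum (bigD1 i) //= apZ ap_dual eqxx mulr1.
rewrite big1 ?addr0 // => j ji; rewrite apZ ap_dual.
by rewrite eq_sym (negbTE ji) mulr0.
Qed.

Lemma dfun_frame g u v : smooth_fun g ->
  dfun g u v = \sum_(j < 4) ap (cof j) u v * frame_der j g u.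
Proof.
move=> sg; rewrite {1}(dual_sum u v) /frame_der.
have dg : differentiable (g \o par (chart_at u)) (coord (chart_at u) u).
  by apply: smooth_on_differentiable (sg _) _; exact: cim_at.
rewrite /dfun (deriveE _ dg) linear_sum; apply: eq_bigr => j _.
by rewrite linearZ /= deriveE.
Qed.

(** A left inverse is the derivative of [coord i], since [coord i \o par i] is
    the identity. *)
Lemma tder_par_inj (i : chart M) y w : cim i y -> tder (par i) y w = 0 -> w = 0.
Proof.
move=> iy; set j := chart_at (par i y) => w0.
have jy : cdom j (par i y) by exact: chart_atP.
have df : differentiable (coord i \o par j) (coord j (par i y)).
  apply: smooth_transition; first exact: cim_coord.
  by rewrite coordK //; exact: cdom_par.
have E := derive_chart (@cim_open _ _ M i) (@smooth_map_par _ _ M i) w iy jy df.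
have w0' : 'D_w (coord j \o par i) y = 0 by exact: w0.
rewrite w0' derive0 in E; rewrite -[RHS]E -[LHS](@derive_id _ _ y w).
apply: near_eq_derive.
have : open_nbhs y (cim i) by split; [exact: (@cim_open _ _ M i)|].
by move=> /open_nbhs_nbhs; apply: filterS => z iz /=; rewrite coord_par.
Qed.

(** The matrix of [cof_mx] refers at each point to the preferred chart there and
    need not vary smoothly; this one refers to the fixed chart [i]. *)
Definition cof_in (i : chart M) (y : 'rV[R]_4) : 'M[R]_4 :=
  \matrix_(k, j) form_in i (cof j) (delta_mx 0 k) y.

Lemma cof_in_mulmx (i : chart M) y (w : 'rV[R]_4) (j : 'I_4) : cim i y ->
  (w *m cof_in i y) 0 j = ap (cof j) (par i y) (tder (par i) y w).
Proof.
move=> iy; rewrite -[RHS]/(form_in i (cof j) w y) form_in_sum // mxE.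
by apply: eq_bigr => k _; rewrite mxE.
Qed.

Lemma cof_in_unit (i : chart M) y : cim i y -> cof_in i y \in unitmx.
Proof.
move=> iy; apply: mx_unit_ker => v v0; apply: (tder_par_inj iy).
by apply: (@cof_inj (par i y)) => j; rewrite -cof_in_mulmx // v0 mxE.
Qed.

Lemma dual_in (i : chart M) y (j : 'I_4) : cim i y ->
  dual j (par i y) = tder (par i) y (row j (invmx (cof_in i y))).
Proof.
move=> iy; apply: (@cof_eq (par i y)) => k; rewrite ap_dual -cof_in_mulmx //.
rewrite -row_mul mulVmx; last exact: cof_in_unit.
by rewrite !mxE eq_sym.
Qed.

Lemma smooth_det (V : normedModType R) (O : set V) n (A : V -> 'M[R]_n) : open O ->
  (forall i j, smooth_on O (fun x => A x i j)) -> smooth_on O (fun x => \det (A x)).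
Proof.
move=> oO sA; apply: smooth_on_sum => // s _; apply: smooth_onM => //.
  exact: smooth_on_cst.
by apply: smooth_on_prod => // i _; exact: sA.
Qed.

Lemma smooth_invmx (V : normedModType R) (O : set V) n (A : V -> 'M[R]_n) : open O ->
  (forall i j, smooth_on O (fun x => A x i j)) ->
  (forall x, O x -> A x \in unitmx) ->
  forall i j, smooth_on O (fun x => invmx (A x) i j).
Proof.
move=> oO sA uA i j.
apply: (@smooth_on_ext _ _ _ _ (fun x => (\det (A x))^-1 *
  ((-1) ^+ (j + i) * \det (row' j (col' i (A x)))))) => //.
  by move=> x /uA ux; rewrite /invmx ux !mxE.
apply: smooth_onM => //.
  apply: smooth_onV => //; first exact: smooth_det.
  by move=> x /uA; rewrite unitmxE unitfE.
apply: smooth_onM => //; first exact: smooth_on_cst.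
apply: smooth_det => // k m.
rewrite (_ : (fun x => _) = fun x => A x (lift j k) (lift i m)); first exact: sA.
by apply/funext => x; rewrite !mxE.
Qed.

(** Cramer's rule makes the dual frame smooth in a chart. *)
Lemma smooth_frame_der j g : smooth_fun g -> smooth_fun (frame_der j g).
Proof.
move=> sg i.
apply: (@smooth_on_ext _ _ _ _ (fun y => \sum_(k < 4)
  invmx (cof_in i y) j k * 'D_(delta_mx 0 k) (g \o par i) y)).
- exact: cim_open.
- move=> y iy; rewrite /= /frame_der dual_in //.
  rewrite -(derive_comp_fun (@cim_open _ _ M i) (@smooth_map_par _ _ M i)) //.
  rewrite (derive_sum_delta (row j (invmx (cof_in i y)))); last first.
    exact: smooth_on_differentiable (sg i) iy.
  by apply: eq_bigr => k _; rewrite mxE.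
have oi := @cim_open _ _ M i.
apply: smooth_on_sum => // k _; apply: smooth_onM => //.
  apply: smooth_invmx => // [p q|x ix]; last exact: cof_in_unit.
  rewrite (_ : (fun x => _) = form_in i (cof q) (delta_mx 0 p)); first exact: cof_smooth.
  by apply/funext => x; rewrite mxE.
exact: smooth_on_derive (sg i).
Qed.

End Frame.

Section Bianchi.
Context {R : realType} {X : manifold R 3}.
Variables (D : X -> {vspace 'rV[R]_3}) (Sigma : manifold R 4).
Variables (pr : Sigma -> X) (vec : Sigma -> 'rV[R]_3).
Variables (C : coframe Sigma) (T : invariants Sigma).
Hypothesis A4 : adapted4 D pr vec C T.

Let Cf : coframing C := adapted0_coframing (adapted4_adapted0 A4).

(** The coefficient of [eta3 /\ eta1] in [d eta1].  Only this combination of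
    [A2] with [I K] is differentiated below. *)
Definition fZ (u : Sigma) : R := fA2 T u + 2^-1 * fI T u * fK T u.

Lemma smooth_fZ : smooth_fun fZ.
Proof.
have [[sI _ _ sK _] [sA2 _ _ _]] := adapted4_smooth A4.
move=> i; have oi := @cim_open _ _ Sigma i.
apply: (smooth_onD oi (sA2 i)); apply: (smooth_onM oi); last exact: sK.
by apply: (smooth_onM oi); [exact: smooth_on_cst|exact: sI].
Qed.

Section Structure.
Context {V : normedModType R}.
Variables (O : set V) (c : V -> Sigma).
Hypotheses (oO : open O) (sc : smooth_map O c).

Notation n1 := (pull c (eta1 C)).
Notation n2 := (pull c (eta2 C)).
Notation n3 := (pull c (eta3 C)).
Notation n4 := (pull c (phi C)).

Lemma dflat_eta1 v w x : O x -> dflat n1 v w x =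
  wflat n2 n4 v w x + fA1 T (c x) * wflat n2 n3 v w x
  + fZ (c x) * wflat n3 n1 v w x + fJ1 T (c x) * wflat n3 n4 v w x.
Proof.
move=> Ox; rewrite /dflat (extd_pull oO sc) //; last by exact: (cof_smooth Cf 0).
exact: (adapted4_eta1 A4).
Qed.

Lemma dflat_eta2 v w x : O x -> dflat n2 v w x =
  - wflat n1 n4 v w x + (fZ (c x) - fI T (c x) * fK T (c x)) * wflat n2 n3 v w x
  - fA1 T (c x) * wflat n3 n1 v w x + fJ2 T (c x) * wflat n3 n4 v w x
  + fI T (c x) * wflat n2 n4 v w x.
Proof.
move=> Ox; rewrite /dflat (extd_pull oO sc) //; last by exact: (cof_smooth Cf 1).
rewrite (adapted4_eta2 A4) (_ : fZ (c x) - _ = fA2 T (c x) - 2^-1 * fI T (c x) * fK T (c x)) //.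
by rewrite /fZ; field.
Qed.

Lemma dflat_eta3 v w x : O x -> dflat n3 v w x =
  wflat n1 n2 v w x + fI T (c x) * wflat n3 n4 v w x.
Proof.
move=> Ox; rewrite /dflat (extd_pull oO sc) //; last by exact: (cof_smooth Cf 2).
exact: (adapted4_eta3 A4).
Qed.

Lemma dflat_phi v w x : O x -> dflat n4 v w x =
  fS0 T (c x) * wflat n3 n4 v w x + fS1 T (c x) * wflat n2 n3 v w x
  + fS2 T (c x) * wflat n3 n1 v w x - fJ1 T (c x) * wflat n1 n4 v w x
  - 2 * fJ2 T (c x) * wflat n2 n4 v w x + fK T (c x) * wflat n1 n2 v w x.
Proof.
move=> Ox; rewrite /dflat (extd_pull oO sc) //; last by exact: (cof_smooth Cf 3).
exact: (adapted4_phi A4).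
Qed.

End Structure.

Section AtPoint.
Variable u : Sigma.
Let i := chart_at u.
Let y := coord i u.
Let oi : open (cim i) := @cim_open _ _ Sigma i.
Let iy : cim i y := cim_at u.
Notation c := (par i).
Notation e := (fun j => dual C j u).

Lemma par_coord : c y = u. Proof. exact/coordK/chart_atP. Qed.

Lemma tder_par_at v : tder c y v = v.
Proof.
rewrite /tder par_coord -[RHS](@derive_id _ _ y v); apply: near_eq_derive.
have : open_nbhs y (cim i) by split.
by move=> /open_nbhs_nbhs; apply: filterS => z iz /=; rewrite coord_par.
Qed.

Lemma pull_dual (k j : 'I_4) : pull c (cof C k) (e j) y = (k == j)%:R.
Proof. by rewrite /pull tder_par_at par_coord ap_dual. Qed.

Let smp k v : smooth_on (cim i) (pull c (cof C k) v).
Proof. by apply: smooth_pull => //; [exact: smooth_map_par|exact: cof_smooth]. Qed.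

(** In the preferred chart at [u] the parametrization [par i] has derivative
    the identity at [u] itself, so that the frame vectors at [u] can be used as
    constant vector fields. *)
Lemma bianchi3 (j k l : 'I_4) : \sum_(t <- [:: (cst 1, pull c (eta1 C), pull c (eta2 C));
    (fI T \o c, pull c (eta3 C), pull c (phi C))]) dterm t (e j) (e k) (e l) y = 0.
Proof.
have [[sI _ _ _ _] _] := adapted4_smooth A4.
apply: (@bianchi _ _ (cim i) oi (pull c (eta3 C))) => //.
- by move=> v; exact: (smp 2).
- case=> [|[|//]] _ /=; split; by [exact: smooth_on_cst|exact: (smp 0)
    |exact: (smp 1)|exact: (smp 2)|exact: (smp 3)|exact: sI].
- move=> v w x Ox; rewrite (dflat_eta3 oi) //; last exact: smooth_map_par.
  by rewrite /tsum !big_cons big_nil /= mul1r addr0.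
Qed.

Lemma bianchi1 (j k l : 'I_4) : \sum_(t <- [:: (cst 1, pull c (eta2 C), pull c (phi C));
    (fA1 T \o c, pull c (eta2 C), pull c (eta3 C));
    (fZ \o c, pull c (eta3 C), pull c (eta1 C));
    (fJ1 T \o c, pull c (eta3 C), pull c (phi C))]) dterm t (e j) (e k) (e l) y = 0.
Proof.
have [[_ sJ1 _ _ sA1] _] := adapted4_smooth A4.
apply: (@bianchi _ _ (cim i) oi (pull c (eta1 C))) => //.
- by move=> v; exact: (smp 0).
- case=> [|[|[|[|//]]]] _ /=; split; by [exact: smooth_on_cst|exact: (smp 0)
    |exact: (smp 1)|exact: (smp 2)|exact: (smp 3)|exact: sA1|exact: sJ1|exact: smooth_fZ].
- move=> v w x Ox; rewrite (dflat_eta1 oi) //; last exact: smooth_map_par.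
  by rewrite /tsum !big_cons big_nil /= mul1r addr0 !addrA.
Qed.

Let ev k j : pull c (cof C (nat_of_ord k)) (e j) y = (k == j)%:R := pull_dual k j.

Notation o0 := (@Ordinal 4 0 isT).
Notation o1 := (@Ordinal 4 1 isT).
Notation o2 := (@Ordinal 4 2 isT).
Notation o3 := (@Ordinal 4 3 isT).
Notation E k g := (frame_der C k g u).

Lemma pull_dual4 :
  ((forall j, pull c (eta1 C) (e j) y = (o0 == j)%:R) *
   (forall j, pull c (eta2 C) (e j) y = (o1 == j)%:R) *
   (forall j, pull c (eta3 C) (e j) y = (o2 == j)%:R) *
   (forall j, pull c (phi C) (e j) y = (o3 == j)%:R))%type.
Proof.
split; [split; [split|]|] => j;
  by [exact: (ev o0)|exact: (ev o1)|exact: (ev o2)|exact: (ev o3)].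
Qed.

Notation m1 := (pull c (eta1 C)).
Notation m2 := (pull c (eta2 C)).
Notation m3 := (pull c (eta3 C)).
Notation m4 := (pull c (phi C)).

Let sp : smooth_map (cim i) c := @smooth_map_par _ _ _ i.

Let dm1 v w : dflat m1 v w y = wflat m2 m4 v w y + fA1 T u * wflat m2 m3 v w y
  + fZ u * wflat m3 m1 v w y + fJ1 T u * wflat m3 m4 v w y.
Proof. by rewrite (dflat_eta1 oi sp _ _ iy) par_coord. Qed.

Let dm2 v w : dflat m2 v w y = - wflat m1 m4 v w y
  + (fZ u - fI T u * fK T u) * wflat m2 m3 v w y - fA1 T u * wflat m3 m1 v w y
  + fJ2 T u * wflat m3 m4 v w y + fI T u * wflat m2 m4 v w y.
Proof. by rewrite (dflat_eta2 oi sp _ _ iy) par_coord. Qed.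

Let dm3 v w : dflat m3 v w y = wflat m1 m2 v w y + fI T u * wflat m3 m4 v w y.
Proof. by rewrite (dflat_eta3 oi sp _ _ iy) par_coord. Qed.

Let dm4 v w : dflat m4 v w y = fS0 T u * wflat m3 m4 v w y
  + fS1 T u * wflat m2 m3 v w y + fS2 T u * wflat m3 m1 v w y
  - fJ1 T u * wflat m1 m4 v w y - 2 * fJ2 T u * wflat m2 m4 v w y
  + fK T u * wflat m1 m2 v w y.
Proof. by rewrite (dflat_phi oi sp _ _ iy) par_coord. Qed.

Lemma frame_derE j g : 'D_(e j) (g \o c) y = E j g.
Proof. by []. Qed.

(* The terms are large; [ring] is fast only on variables. *)
Ltac generalize_invariants :=
  move: (E o0 (fA1 T)) (E o1 (fA1 T)) (E o2 (fA1 T)) (E o3 (fA1 T));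
  move: (E o0 fZ) (E o1 fZ) (E o2 fZ) (E o3 fZ);
  move: (E o0 (fJ1 T)) (E o1 (fJ1 T)) (E o2 (fJ1 T)) (E o3 (fJ1 T));
  move: (fI T u) (fJ1 T u) (fJ2 T u) (fK T u) (fA1 T u) (fZ u)
    (fS0 T u) (fS1 T u) (fS2 T u);
  move=> *.

(** The relations among the derivatives of the invariants that follow from
    [d (d eta3) = 0] and [d (d eta1) = 0]: each is the value of [bianchi3] or
    [bianchi1] on one triple of frame vectors. *)
Lemma bianchi_I1 : E o0 (fI T) = fJ2 T u + fI T u * fJ1 T u.
Proof.
have := bianchi3 o0 o2 o3.
rewrite !big_cons big_nil /dterm !(dm1, dm2, dm3, dm4) /wflat !pull_dual4 /=.
rewrite !frame_derE !derive_cst /cst /= !par_coord => H.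
apply/eqP; rewrite -subr_eq0 -H; apply/eqP; ring.
Qed.

Lemma bianchi_I2 : E o1 (fI T) = 2 * fI T u * fJ2 T u - fJ1 T u.
Proof.
have := bianchi3 o1 o2 o3.
rewrite !big_cons big_nil /dterm !(dm1, dm2, dm3, dm4) /wflat !pull_dual4 /=.
rewrite !frame_derE !derive_cst /cst /= !par_coord => H.
apply/eqP; rewrite -subr_eq0 -H; apply/eqP; ring.
Qed.

Lemma bianchi_Z4 : E o3 fZ = 2 * fA1 T u - fJ1 T u ^+ 2 + E o0 (fJ1 T) + fI T u * fZ u.
Proof.
have := bianchi1 o3 o2 o0.
rewrite !big_cons big_nil /dterm !(dm1, dm2, dm3, dm4) /wflat !pull_dual4 /=.
rewrite !frame_derE !derive_cst /cst /= !par_coord => H.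
apply/eqP; rewrite -subr_eq0 -H; apply/eqP.
generalize_invariants; ring.
Qed.

Lemma bianchi_Z2 : E o1 fZ = fJ1 T u * fK T u + fS2 T u - E o0 (fA1 T).
Proof.
have := bianchi1 o0 o1 o2.
rewrite !big_cons big_nil /dterm !(dm1, dm2, dm3, dm4) /wflat !pull_dual4 /=.
rewrite !frame_derE !derive_cst /cst /= !par_coord => H.
apply/eqP; rewrite -subr_eq0 -H; apply/eqP.
generalize_invariants; ring.
Qed.

Lemma bianchi_J12 : E o1 (fJ1 T) = 2 * fI T u * fA1 T u + 2 * fJ1 T u * fJ2 T u + fI T u * fK T u
  - 2 * fZ u + fS0 T u - E o3 (fA1 T).
Proof.
have := bianchi1 o1 o2 o3.
rewrite !big_cons big_nil /dterm !(dm1, dm2, dm3, dm4) /wflat !pull_dual4 /=.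
rewrite !frame_derE !derive_cst /cst /= !par_coord => H.
apply/eqP; rewrite -subr_eq0 -H; apply/eqP.
generalize_invariants; ring.
Qed.

End AtPoint.
End Bianchi.

(** * Integrals over a segment *)

Section Segment.
Context {R : realType}.
Notation mu := (@lebesgue_measure R).
Variables (l : R) (l0 : 0 < l).

Lemma open_near_seg e : open (near_seg l e).
Proof.
rewrite (_ : near_seg l e = `](- e), (l + e)[%classic); first exact: interval_open.
by apply/seteqP; split => s; rewrite /near_seg /= in_itv.
Qed.

Lemma near_segP e s : 0 < e -> 0 <= s <= l -> near_seg l e s.
Proof.
move=> e0 /andP[s0 sl]; rewrite /near_seg /=; apply/andP; split.
  by rewrite (lt_le_trans _ s0) // oppr_lt0.
by rewrite (le_lt_trans sl) // ltrDl.
Qed.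

Lemma derive1D (f : R -> R) : derive1 f = 'D_1 f.
Proof. by apply/funext => s; rewrite derive1E. Qed.

Lemma differentiable_within (f : R -> R) :
  (forall s, 0 <= s <= l -> differentiable f s) -> {within `[0, l], continuous f}.
Proof.
move=> df; apply: continuous_in_subspaceT => s; rewrite inE /= in_itv /= => sl.
exact/differentiable_continuous/df.
Qed.

Lemma differentiable_integrable (f : R -> R) :
  (forall s, 0 <= s <= l -> differentiable f s) ->
  mu.-integrable `[0, l] (EFin \o f).
Proof.
move=> df; apply: continuous_compact_integrable; first exact: segment_compact.
by have := differentiable_within df.
Qed.

Lemma smooth_near_seg e (f : R -> R) s : 0 < e -> smooth_on (near_seg l e) f ->
  0 <= s <= l -> differentiable f s.
Proof.
by move=> e0 sf sl; apply: smooth_on_differentiable sf _; exact: near_segP.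
Qed.

Lemma smooth_within e (f : R -> R) : 0 < e -> smooth_on (near_seg l e) f ->
  {within `[0, l], continuous f}.
Proof.
by move=> e0 sf; apply: differentiable_within => s; exact: smooth_near_seg sf.
Qed.

Lemma smooth_integrable e (f : R -> R) : 0 < e -> smooth_on (near_seg l e) f ->
  mu.-integrable `[0, l] (EFin \o f).
Proof.
by move=> e0 sf; apply: differentiable_integrable => s; exact: smooth_near_seg sf.
Qed.

Lemma integral_derive e (f : R -> R) : 0 < e -> smooth_on (near_seg l e) f ->
  \int[mu]_(s in `[0, l]) 'D_1 f s = f l - f 0.
Proof.
move=> e0 sf; rewrite /Rintegral (@continuous_FTC2 _ _ f) //.
- by have := smooth_within e0 (smooth_on_derive (1 : R) sf).
- have df s : 0 <= s <= l -> {for s, continuous f}.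
    by move=> sl; apply: differentiable_continuous; exact: smooth_near_seg sf sl.
  split.
  + move=> s; rewrite in_itv /= => /andP[s0 sl].
    by apply: diff_derivable; apply: smooth_near_seg sf _; rewrite // !ltW.
  + by apply: cvg_at_right_filter; apply: df; rewrite lexx ltW.
  + by apply: cvg_at_left_filter; apply: df; rewrite lexx ltW.
- by move=> s _; rewrite derive1E.
Qed.

(** A geodesic and its variation agree on the closed segment only, hence their
    derivatives are compared at interior points; smoothness up to the endpoints
    gives the integrability over the open segment. *)
Lemma eq_integral_open e (f g : R -> R) : 0 < e ->
  smooth_on (near_seg l e) f -> smooth_on (near_seg l e) g ->
  (forall s, 0 < s < l -> f s = g s) ->
  \int[mu]_(s in `[0, l]) f s = \int[mu]_(s in `[0, l]) g s.
Proof.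
move=> e0 sf sg fg.
have H h : smooth_on (near_seg l e) h ->
    \int[mu]_(s in `]0, l[) h s = \int[mu]_(s in `[0, l]) h s.
  move=> sh; have ih := smooth_integrable e0 sh.
  rewrite Rintegral_itv_bndo_bndc; last first.
    by apply: integrableS ih => //; exact: subset_itv_oo_cc.
  rewrite Rintegral_itv_obnd_cbnd //.
  by apply: integrableS ih => //; exact: subset_itv_oc_cc.
rewrite -!H //; apply: eq_Rintegral => s; rewrite inE /= in_itv /= => sl.
exact: fg.
Qed.

(** The derivative in the parameter is bounded on the compact rectangle
    [[0, l] x [-e/2, e/2]], and this bound is the dominating function. *)
Lemma derive_under_integral e (K : R * R -> R) (O : set (R * R)) : 0 < e ->
  open O -> (forall s r, 0 <= s <= l -> - e < r < e -> O (s, r)) -> smooth_on O K ->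
  derive1 (fun r => \int[mu]_(s in `[0, l]) K (s, r)) 0 =
  \int[mu]_(s in `[0, l]) 'D_((0, 1) : R * R) K (s, 0).
Proof.
move=> e0 oO HO sK.
have e2 : 0 < e / 2 by rewrite divr_gt0.
have ee : e / 2 < e by rewrite ltr_pdivrMr // ltr_pMr // ltr1n.
pose B : set (R * R) := `[0, l] `*` `[- (e / 2), e / 2].
have BO : B `<=` O.
  move=> [s r] [/=]; rewrite !in_itv /= => sl /andP[r1 r2]; apply: HO => //.
  by rewrite (lt_le_trans _ r1) ?ltrN2 // (le_lt_trans r2).
have dK := smooth_on_derive ((0, 1) : R * R) sK.
have [k kB] : exists k, forall p, B p -> `|'D_((0, 1) : R * R) K p| <= k.
  have cK : {within B, continuous ('D_((0, 1) : R * R) K)}.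
    apply: continuous_in_subspaceT => p; rewrite inE => Bp.
    by apply: differentiable_continuous; exact: smooth_on_differentiable dK (BO _ Bp).
  have /compact_bounded [k [_ kk]] : compact ('D_((0, 1) : R * R) K @` B).
    apply: continuous_compact => //.
    by apply: compact_setX; exact: segment_compact.
  by exists (k + 1) => p Bp; apply: (kk (k + 1)); [rewrite ltrDl|exists p].
have aff s : forall h (u x : R), (s, h *: u + x) = h *: ((0, u) : R * R) + (s, x).
  by move=> h u x; congr pair; rewrite /= ?scaler0 ?add0r.
have d1 s r : 'D_1 (fun r => K (s, r)) r = 'D_((0, 1) : R * R) K (s, r).
  exact: (@derive_affine _ _ _ _ (fun r => (s, r)) (fun u => (0, u)) (aff s)).
have Ir r : (r \in `](- (e / 2)), (e / 2)[%classic) -> - e < r < e.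
  rewrite inE /= in_itv /= => /andP[r1 r2].
  by rewrite (lt_trans _ r1) ?ltrN2 // (lt_trans r2).
have -> : derive1 (fun r => \int[mu]_(s in `[0, l]) K (s, r)) 0 =
    \int[mu]_(s in `[0, l]) (partial1of2 (fun r s => K (s, r)) ^~ s) 0.
  apply: (@differentiation_under_integral R _ _ mu (fun r s => K (s, r)) `[0, l]
    _ 0 (- (e / 2)) (e / 2) _ _ _ (fun=> `|k|)).
- exact: measurable_itv.
- by rewrite /= in_itv /= oppr_lt0 e2.
- move=> r re; apply: differentiable_integrable => s sl.
  apply: (@differentiable_comp _ _ _ _ (fun s => (s, r)) K).
    by apply: differentiable_pair; [|exact: differentiable_cst].
  by apply: smooth_on_differentiable sK _; apply: HO => //; apply: Ir; rewrite inE.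
- move=> r s re /=; rewrite in_itv /= => sl; apply: diff_derivable.
  apply: (@differentiable_comp _ _ _ _ (fun r => (s, r)) K).
    by apply: differentiable_pair; [exact: differentiable_cst|].
  by apply: smooth_on_differentiable sK _; apply: HO => //; apply: Ir; rewrite inE.
- by move=> _; exact: normr_ge0.
- by apply: differentiable_integrable => s _; exact: differentiable_cst.
- move=> r s re /= sl; rewrite partial1of2E d1; apply: le_trans (ler_norm k).
  apply: kB; split=> //=; move: re; rewrite /= !in_itv /= => /andP[r1 r2].
  by rewrite !ltW.
rewrite (_ : partial1of2 _ 0 = fun s => 'D_((0, 1) : R * R) K (s, 0)) //.
by apply/funext => s; rewrite partial1of2E d1.
Qed.

Lemma jacobi_op_smooth e P Q f : smooth_on (near_seg l e) P ->
  smooth_on (near_seg l e) Q -> smooth_on (near_seg l e) f ->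
  smooth_on (near_seg l e) (jacobi_op P Q f).
Proof.
move=> sP sQ sf; have oe := @open_near_seg e.
rewrite /jacobi_op !derive1nS derive1n0 !derive1D.
apply: smooth_onD => //; last exact: smooth_onM.
apply: smooth_onD => //; first by do 4! apply: smooth_on_derive.
by apply: smooth_on_derive; apply: smooth_onM => //; exact: smooth_on_derive.
Qed.

Lemma smooth_seg_min e1 e2 (f : R -> R) : smooth_on (near_seg l e1) f ->
  smooth_on (near_seg l (Num.min e1 e2)) f.
Proof.
apply: smooth_on_sub => s /andP[s1 s2]; rewrite /near_seg /=.
have m1 : Num.min e1 e2 <= e1 by rewrite ge_min lexx.
apply/andP; split; first by apply: le_lt_trans s1; rewrite lerN2.
by apply: lt_le_trans s2 _; rewrite lerD2l.
Qed.

End Segment.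

Section SelfAdjoint.
Context {R : realType}.
Notation mu := (@lebesgue_measure R).
Variables (l : R) (l0 : 0 < l).

Lemma jacobi_opE e (P Q f : R -> R) s : 0 < e -> smooth_on (near_seg l e) P ->
  smooth_on (near_seg l e) f -> near_seg l e s ->
  jacobi_op P Q f s = 'D_1 ('D_1 ('D_1 ('D_1 f))) s + P s * 'D_1 ('D_1 f) s
    + 'D_1 P s * 'D_1 f s + Q s * f s.
Proof.
move=> e0 sP sf Os; rewrite /jacobi_op !derive1nS derive1n0 !derive1D.
have dP : differentiable P s by exact: smooth_on_differentiable sP Os.
have df : differentiable ('D_1 f) s.
  by exact: smooth_on_differentiable (smooth_on_derive (1 : R) sf) Os.
by rewrite (derive_M _ dP df) addrA (mulrC ('D_1 f s)).
Qed.

(** Lagrange's identity for [u'''' + (P u')' + Q u]: the antisymmetric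
    combination of two functions is the derivative of a bilinear expression
    that vanishes where both functions vanish to first order. *)
Lemma wronskian_derive (f f1 f2 f3 g g1 g2 g3 P : R -> R) (s f4 g4 P1 : R) :
  is_derive s 1 f (f1 s) -> is_derive s 1 f1 (f2 s) -> is_derive s 1 f2 (f3 s) ->
  is_derive s 1 f3 f4 -> is_derive s 1 g (g1 s) -> is_derive s 1 g1 (g2 s) ->
  is_derive s 1 g2 (g3 s) -> is_derive s 1 g3 g4 -> is_derive s 1 P P1 ->
  is_derive s 1 (fun s => g s * f3 s - g1 s * f2 s + (g2 s * f1 s - g3 s * f s)
                          + P s * (g s * f1 s - f s * g1 s))
    (g s * (f4 + P s * f2 s + P1 * f1 s) - f s * (g4 + P s * g2 s + P1 * g1 s)).
Proof.
move=> Hf Hf1 Hf2 Hf3 Hg Hg1 Hg2 Hg3 HP; apply: is_derive_eq.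
by rewrite /GRing.scale /=; ring.
Qed.

Lemma wronskian_smooth (O : set R) (f f1 f2 f3 g g1 g2 g3 P : R -> R) : open O ->
  smooth_on O f -> smooth_on O f1 -> smooth_on O f2 -> smooth_on O f3 ->
  smooth_on O g -> smooth_on O g1 -> smooth_on O g2 -> smooth_on O g3 ->
  smooth_on O P ->
  smooth_on O (fun s => g s * f3 s - g1 s * f2 s + (g2 s * f1 s - g3 s * f s)
                        + P s * (g s * f1 s - f s * g1 s)).
Proof.
move=> oO sf sf1 sf2 sf3 sg sg1 sg2 sg3 sP.
apply: (smooth_onD oO).
  by apply: (smooth_onD oO); apply: (smooth_onB oO); apply: (smooth_onM oO).
by apply: (smooth_onM oO) => //; apply: (smooth_onB oO); apply: (smooth_onM oO).
Qed.

Lemma jacobi_self_adjoint (P Q : R -> R) : smooth_seg l P -> smooth_seg l Q ->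
  self_adjoint l (jacobi_op P Q).
Proof.
move=> [eP eP0 sP] [eQ eQ0 sQ] f g [ef ef0 sf] [eg eg0 sg] [f0 f0' fl fl'] [g0 g0' gl gl'].
pose e := Num.min (Num.min eP eQ) (Num.min ef eg).
have e0 : 0 < e by rewrite !lt_min eP0 eQ0 ef0 eg0.
have mono e' (h : R -> R) : e <= e' -> smooth_on (near_seg l e') h -> smooth_on (near_seg l e) h.
  by move=> /min_idPr ee' sh; have := smooth_seg_min (e2 := e) sh; rewrite ee'.
have {}sP : smooth_on (near_seg l e) P by apply: mono sP; rewrite !ge_min lexx.
have {}sQ : smooth_on (near_seg l e) Q by apply: mono sQ; rewrite !ge_min lexx orbT.
have {}sf : smooth_on (near_seg l e) f by apply: mono sf; rewrite !ge_min lexx !orbT.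
have {}sg : smooth_on (near_seg l e) g by apply: mono sg; rewrite !ge_min lexx !orbT.
clearbody e.
have oe := @open_near_seg R l e.
have sJf := jacobi_op_smooth sP sQ sf.
have sJg := jacobi_op_smooth sP sQ sg.
have sD (h : R -> R) : smooth_on (near_seg l e) h -> smooth_on (near_seg l e) ('D_1 h).
  by exact: smooth_on_derive.
rewrite !derive1D in f0' fl' g0' gl'.
have sf1 := sD _ sf; have sf2 := sD _ sf1; have sf3 := sD _ sf2.
have sg1 := sD _ sg; have sg2 := sD _ sg1; have sg3 := sD _ sg2.
pose H s := g s * 'D_1 ('D_1 ('D_1 f)) s - 'D_1 g s * 'D_1 ('D_1 f) s
  + ('D_1 ('D_1 g) s * 'D_1 f s - 'D_1 ('D_1 ('D_1 g)) s * f s)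
  + P s * (g s * 'D_1 f s - f s * 'D_1 g s).
have sH : smooth_on (near_seg l e) H :=
  wronskian_smooth oe sf sf1 sf2 sf3 sg sg1 sg2 sg3 sP.
have DH s : near_seg l e s ->
    'D_1 H s = g s * jacobi_op P Q f s - f s * jacobi_op P Q g s.
  move=> Os; have d (h : R -> R) : smooth_on (near_seg l e) h -> is_derive s 1 h ('D_1 h s).
    by move=> sh; exact/derivableP/diff_derivable/(smooth_on_differentiable sh Os).
  have := wronskian_derive (d _ sf) (d _ sf1) (d _ sf2) (d _ sf3)
    (d _ sg) (d _ sg1) (d _ sg2) (d _ sg3) (d _ sP).
  case=> _ dH; rewrite -/H in dH; rewrite dH.
  rewrite (jacobi_opE _ e0 sP sf Os) (jacobi_opE _ e0 sP sg Os).
  have alg (p p' q a b a1 b1 a2 b2 a4 b4 : R) :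
    b * (a4 + p * a2 + p' * a1) - a * (b4 + p * b2 + p' * b1) =
    b * (a4 + p * a2 + p' * a1 + q * a) - a * (b4 + p * b2 + p' * b1 + q * b) by ring.
  exact: alg.
apply/eqP; rewrite -subr_eq0; apply/eqP.
have i1 : smooth_on (near_seg l e) (fun s => g s * jacobi_op P Q f s) by exact: smooth_onM.
have i2 : smooth_on (near_seg l e) (fun s => f s * jacobi_op P Q g s) by exact: smooth_onM.
have m0 : measurable (`[0, l]%classic : set (measurableTypeR R)) by exact: measurable_itv.
rewrite -(RintegralB m0 (smooth_integrable e0 i1) (smooth_integrable e0 i2)).
have i3 : smooth_on (near_seg l e)
   (fun s => g s * jacobi_op P Q f s - f s * jacobi_op P Q g s) by exact: smooth_onB.
rewrite (eq_integral_open e0 i3 (sD _ sH)); last first.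
  move=> s /andP[s0 sl]; rewrite DH //.
  by apply: near_segP; rewrite // !ltW.
rewrite (integral_derive l0 e0 sH).
have alg (a a1 a2 a3 b b1 b2 b3 p : R) : a = 0 -> a1 = 0 -> b = 0 -> b1 = 0 ->
    b * a3 - b1 * a2 + (b2 * a1 - b3 * a) + p * (b * a1 - a * b1) = 0.
  by move=> -> -> -> ->; ring.
have -> : H l = 0 by exact: (alg _ _ _ _ _ _ _ _ _ fl fl' gl gl').
have -> : H 0 = 0 by exact: (alg _ _ _ _ _ _ _ _ _ f0 f0' g0 g0').
by rewrite subrr.
Qed.

End SelfAdjoint.

(** * Variations of horizontal lifts *)

Lemma is_derive_diff (R : realType) (V : normedModType R) (f : V -> R) x v :
  differentiable f x -> is_derive x v f ('D_v f x).
Proof. by move=> df; exact/derivableP/diff_derivable. Qed.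

Lemma sum_ord4 (R : nmodType) (F : 'I_4 -> R) :
  \sum_j F j = F (@Ordinal 4 0 isT) + F (@Ordinal 4 1 isT) + F (@Ordinal 4 2 isT)
    + F (@Ordinal 4 3 isT).
Proof.
rewrite !big_ord_recr big_ord0 /= add0r.
by congr (F _ + F _ + F _ + F _); exact: val_inj.
Qed.

Section Lifts.
Context {R : realType} {X : manifold R 3}.
Variables (D : X -> {vspace 'rV[R]_3}) (Sigma : manifold R 4).
Variables (pr : Sigma -> X) (vec : Sigma -> 'rV[R]_3).
Variables (C : coframe Sigma) (T : invariants Sigma).
Hypothesis A4 : adapted4 D pr vec C T.

Let Cf : coframing C := adapted0_coframing (adapted4_adapted0 A4).

Notation o0 := (@Ordinal 4 0 isT).
Notation o1 := (@Ordinal 4 1 isT).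
Notation o2 := (@Ordinal 4 2 isT).
Notation o3 := (@Ordinal 4 3 isT).
Notation E k g := (frame_der C k g).

(** The function with [eta5 = d lambda - fLam eta1]. *)
Definition fLam (y : Y Sigma) : R :=
  y.2 ^+ 2 * fI T y.1 + y.2 * fJ1 T y.1 + fZ T y.1.

(** The derivative of [fLam] along the [k]-th frame vector of Sigma, at fixed
    lambda. *)
Definition fLamE (k : 'I_4) (y : Y Sigma) : R :=
  y.2 ^+ 2 * E k (fI T) y.1 + y.2 * E k (fJ1 T) y.1 + E k (fZ T) y.1.

Context {V : normedModType R}.
Variables (O : set V) (G : V -> Y Sigma).
Hypotheses (oO : open O) (sG : smooth_mapY O G).

Notation c := (fst \o G).
Notation lam := (snd \o G : V -> R).
Notation n1 := (pull c (eta1 C)).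
Notation n2 := (pull c (eta2 C)).
Notation n3 := (pull c (eta3 C)).
Notation n4 := (pull c (phi C)).

(* The forms [eta4] and [eta5] of Y, pulled back by [G]. *)
Definition eta4_along (v x : V) : R := n4 v x - lam x * n1 v x.
Definition eta5_along (v x : V) : R := 'D_v lam x - fLam (G x) * n1 v x.

Lemma etaY2 x v : etaY C T 2 (G x) (tderY G x v) = n2 v x.
Proof. by rewrite /pull /tderY /=; case: (G x). Qed.
Lemma etaY3 x v : etaY C T 3 (G x) (tderY G x v) = n3 v x.
Proof. by rewrite /pull /tderY /=; case: (G x). Qed.
Lemma etaY4 x v : etaY C T 4 (G x) (tderY G x v) = eta4_along v x.
Proof. by rewrite /eta4_along /pull /tderY /=; case: (G x). Qed.
Lemma etaY5 x v : etaY C T 5 (G x) (tderY G x v) = eta5_along v x.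
Proof. by rewrite /eta5_along /pull /tderY /fLam /fZ /=; case: (G x) => u r /=; rewrite !addrA. Qed.

Let sc : smooth_map O c := sG.1.
Let slam : smooth_on O lam := sG.2.

Lemma smooth_n k v : smooth_on O (pull c (cof C k) v).
Proof. by apply: (smooth_pull oO sc); exact: cof_smooth. Qed.

Let sn1 v : smooth_on O (n1 v) := smooth_n 0 v.
Let sn2 v : smooth_on O (n2 v) := smooth_n 1 v.
Let sn3 v : smooth_on O (n3 v) := smooth_n 2 v.
Let sn4 v : smooth_on O (n4 v) := smooth_n 3 v.

Lemma smooth_Lam : smooth_on O (fLam \o G).
Proof.
have [[sI sJ1 _ _ _] _] := adapted4_smooth A4.
have H (a b d e : V -> R) : smooth_on O a -> smooth_on O b -> smooth_on O d ->
    smooth_on O e -> smooth_on O (fun x => a x ^+ 2 * b x + a x * d x + e x).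
  move=> sa sb sd se; apply: (smooth_onD oO) => //; apply: (smooth_onD oO).
    by apply: (smooth_onM oO) => //; exact: smooth_onX.
  exact: smooth_onM.
exact: (H _ _ _ _ slam (smooth_comp_fun oO sc sI) (smooth_comp_fun oO sc sJ1)
  (smooth_comp_fun oO sc (smooth_fZ A4))).
Qed.

Lemma smooth_eta5_along v : smooth_on O (eta5_along v).
Proof.
have H (a b d : V -> R) : smooth_on O a -> smooth_on O b -> smooth_on O d ->
    smooth_on O (fun x => a x - b x * d x).
  by move=> sa sb sd; apply: (smooth_onB oO) => //; exact: smooth_onM.
exact: (H _ _ _ (smooth_on_derive v slam) smooth_Lam (sn1 v)).
Qed.

Lemma derive_frame g x v : smooth_fun g -> O x ->
  'D_v (g \o c) x = n1 v x * E o0 g (c x) + n2 v x * E o1 g (c x)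
    + n3 v x * E o2 g (c x) + n4 v x * E o3 g (c x).
Proof.
move=> sg Ox; rewrite (derive_comp_fun oO sc v sg Ox) (dfun_frame Cf) //.
exact: sum_ord4.
Qed.

Lemma is_derive_poly (a b d e : V -> R) x v a' b' d' e' :
  is_derive x v a a' -> is_derive x v b b' -> is_derive x v d d' ->
  is_derive x v e e' ->
  is_derive x v (fun x => a x ^+ 2 * b x + a x * d x + e x)
    ((2 * a x * b x + d x) * a' + (a x ^+ 2 * b' + a x * d' + e')).
Proof.
move=> Ha Hb Hd He; have Ha2 : is_derive x v (fun x => a x * a x) (2 * a x * a').
  by apply: is_derive_eq; rewrite /GRing.scale /=; ring.
by apply: is_derive_eq; rewrite /GRing.scale /=; ring.
Qed.

Lemma derive_Lam x v : O x -> 'D_v (fLam \o G) x =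
  (2 * lam x * fI T (c x) + fJ1 T (c x)) * 'D_v lam x
  + n1 v x * fLamE o0 (G x) + n2 v x * fLamE o1 (G x)
  + n3 v x * fLamE o2 (G x) + n4 v x * fLamE o3 (G x).
Proof.
move=> Ox; have [[sI sJ1 _ _ _] _] := adapted4_smooth A4.
have d (g : V -> R) : smooth_on O g -> is_derive x v g ('D_v g x).
  by move=> sg; exact: is_derive_diff (smooth_on_differentiable sg Ox).
have [_ ->] := is_derive_poly (d _ slam) (d _ (smooth_comp_fun oO sc sI))
  (d _ (smooth_comp_fun oO sc sJ1)) (d _ (smooth_comp_fun oO sc (smooth_fZ A4))).
rewrite (derive_frame v sI Ox) (derive_frame v sJ1 Ox) (derive_frame v (smooth_fZ A4) Ox).
rewrite /fLamE /=.
have alg (a b f a' i0 i1 i2 i3 j0 j1 j2 j3 z0 z1 z2 z3 m1 m2 m3 m4 : R) :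
  (2 * a * b + f) * a' + (a ^+ 2 * (m1 * i0 + m2 * i1 + m3 * i2 + m4 * i3)
    + a * (m1 * j0 + m2 * j1 + m3 * j2 + m4 * j3) + (m1 * z0 + m2 * z1 + m3 * z2 + m4 * z3))
  = (2 * a * b + f) * a' + m1 * (a ^+ 2 * i0 + a * j0 + z0) + m2 * (a ^+ 2 * i1 + a * j1 + z1)
    + m3 * (a ^+ 2 * i2 + a * j2 + z2) + m4 * (a ^+ 2 * i3 + a * j3 + z3) by ring.
exact: alg.
Qed.

Section FirstVariation.
(* [p] is the direction of a family of horizontal lifts, [w] that of a variation
   through such lifts. *)
Variables (x p w : V).
Hypotheses (Ox : O x) (p2 : n2 p x = 0) (p3 : n3 p x = 0) (p4 : eta4_along p x = 0).

Let p4' : n4 p x = lam x * n1 p x.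
Proof. by apply/eqP; rewrite -subr_eq0; apply/eqP; exact: p4. Qed.

Hypothesis w3 : 'D_w (n3 p) x = 0.

Lemma derive_eta3 :
  'D_p (n3 w) x = n1 p x * (n2 w x - lam x * fI T (c x) * n3 w x).
Proof.
have alg (dp dw a1 a2 a3 a4 b1 b2 b3 b4 r i : R) :
    dp - dw = (a1 * b2 - b1 * a2) + i * (a3 * b4 - b3 * a4) ->
    dw = 0 -> a2 = 0 -> a3 = 0 -> a4 = r * a1 -> dp = a1 * (b2 - r * i * b3).
  by move=> H h1 h2 h3 h4; move: H; rewrite h1 h2 h3 h4 subr0 => ->; ring.
exact: (alg _ _ _ _ _ _ _ _ _ _ _ _ (dflat_eta3 A4 oO sc p w Ox) w3 p2 p3 p4').
Qed.

(** [d (eta1 + lambda eta3)] is a combination of [eta5 /\ eta3] and of products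
    of two of [eta2], [eta3], [eta4], which all vanish on [p]: only
    [eta5 /\ eta3] survives. *)
Lemma first_variation : 'D_w (n1 p) x =
  'D_p (fun x => n1 w x + lam x * n3 w x) x - eta5_along p x * n3 w x.
Proof.
have dn1 := smooth_on_differentiable (sn1 w) Ox.
have dn3 := smooth_on_differentiable (sn3 w) Ox.
have dl := smooth_on_differentiable slam Ox.
have -> : 'D_p (fun x => n1 w x + lam x * n3 w x) x =
    'D_p (n1 w) x + (lam x * 'D_p (n3 w) x + n3 w x * 'D_p lam x).
  by rewrite -(derive_M _ dl dn3) -(derive_D _ dn1 (differentiableM dl dn3)).
have alg (dp dw dp3 dl' a1 a2 a3 a4 b1 b2 b3 b4 r i j z k : R) :
    dp - dw = (a2 * b4 - b2 * a4) + k * (a2 * b3 - b2 * a3) + z * (a3 * b1 - b3 * a1)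
      + j * (a3 * b4 - b3 * a4) ->
    dp3 = a1 * (b2 - r * i * b3) -> a2 = 0 -> a3 = 0 -> a4 = r * a1 ->
    dw = dp + (r * dp3 + b3 * dl') - (dl' - (r ^+ 2 * i + r * j + z) * a1) * b3.
  move=> H -> h2 h3 h4; move: H; rewrite h2 h3 h4 => H.
  have -> : dw = dp - (dp - dw) by ring.
  by rewrite H; ring.
exact: (alg _ _ _ _ _ _ _ _ _ _ _ _ _ _ _ _ _ (dflat_eta1 A4 oO sc p w Ox)
  derive_eta3 p2 p3 p4').
Qed.

End FirstVariation.

Section SecondVariation.
(* At a point of a geodesic, [eta5] vanishes on [p] as well and the speed is 1:
   the structure equations give the linearized system for the components of
   [w]. *)
Variables (x p w : V).
Hypotheses (Ox : O x) (p1 : n1 p x = 1) (p2 : n2 p x = 0) (p3 : n3 p x = 0)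
  (p4 : eta4_along p x = 0) (p5 : eta5_along p x = 0).
Hypotheses (w2 : 'D_w (n2 p) x = 0) (w3 : 'D_w (n3 p) x = 0)
  (w4 : 'D_w (eta4_along p) x = 0).

Let p4' : n4 p x = lam x.
Proof. by apply/eqP; rewrite -subr_eq0; apply/eqP; move: p4; rewrite /eta4_along p1 mulr1. Qed.

Let p5' : 'D_p lam x = fLam (G x).
Proof. by apply/eqP; rewrite -subr_eq0; apply/eqP; move: p5; rewrite /eta5_along p1 mulr1. Qed.

Let dn1 v := smooth_on_differentiable (sn1 v) Ox.
Let dn3 v := smooth_on_differentiable (sn3 v) Ox.
Let dn4 v := smooth_on_differentiable (sn4 v) Ox.
Let dl := smooth_on_differentiable slam Ox.

Lemma center_eta3 : 'D_p (n3 w) x = n2 w x - lam x * fI T (c x) * n3 w x.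
Proof. by rewrite (derive_eta3 Ox p2 p3 p4 w3) p1 mul1r. Qed.

Lemma center_eta2 : 'D_p (n2 w) x = - eta4_along w x
  + (fA1 T (c x) - lam x * fJ2 T (c x)) * n3 w x - lam x * fI T (c x) * n2 w x.
Proof.
have alg (dp dw a1 a2 a3 a4 b1 b2 b3 b4 r i j k z : R) :
    dp - dw = - (a1 * b4 - b1 * a4) + z * (a2 * b3 - b2 * a3) - k * (a3 * b1 - b3 * a1)
      + j * (a3 * b4 - b3 * a4) + i * (a2 * b4 - b2 * a4) ->
    dw = 0 -> a1 = 1 -> a2 = 0 -> a3 = 0 -> a4 = r ->
    dp = - (b4 - r * b1) + (k - r * j) * b3 - r * i * b2.
  by move=> H h1 h2 h3 h4 h5'; move: H; rewrite h1 h2 h3 h4 h5' subr0 => ->; ring.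
exact: (alg _ _ _ _ _ _ _ _ _ _ _ _ _ _ _ (dflat_eta2 A4 oO sc p w Ox) w2 p1 p2 p3 p4').
Qed.

Lemma center_eta1 :
  'D_w (n1 p) x = 'D_p (n1 w) x + (lam x * 'D_p (n3 w) x + n3 w x * fLam (G x)).
Proof.
apply: (etrans (first_variation Ox p2 p3 p4 w3)).
have -> : 'D_p (fun x => n1 w x + lam x * n3 w x) x =
    'D_p (n1 w) x + (lam x * 'D_p (n3 w) x + n3 w x * 'D_p lam x).
  rewrite -(derive_M _ dl (dn3 w)).
  by rewrite -(derive_D _ (dn1 w) (differentiableM dl (dn3 w))).
by rewrite p5' p5 mul0r subr0.
Qed.

Let lamw : 'D_w lam x = eta5_along w x + fLam (G x) * n1 w x.
Proof. by rewrite /eta5_along subrK. Qed.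

Lemma center_eta4 : 'D_p (eta4_along w) x = eta5_along w x
  + (lam x ^+ 2 + 2 * (lam x * fJ2 T (c x)) + fK T (c x)) * n2 w x
  - fJ1 T (c x) * eta4_along w x
  + (lam x * (fZ T (c x) + lam x * fJ1 T (c x)) - lam x * fS0 T (c x) - fS2 T (c x))
    * n3 w x.
Proof.
have Hp : 'D_p (eta4_along w) x = 'D_p (n4 w) x - (lam x * 'D_p (n1 w) x + n1 w x * 'D_p lam x).
  by rewrite -(derive_M _ dl (dn1 w)) -(derive_B _ (dn4 w) (differentiableM dl (dn1 w))).
have Hw : 'D_w (eta4_along p) x = 'D_w (n4 p) x - (lam x * 'D_w (n1 p) x + n1 p x * 'D_w lam x).
  by rewrite -(derive_M _ dl (dn1 p)) -(derive_B _ (dn4 p) (differentiableM dl (dn1 p))).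
have alg (hp hw p4d w4d p1d w1d p3d pl wl a1 a2 a3 a4 b1 b2 b3 b4 b5 r i j j2 k s0 s1 s2 z : R) :
    p4d - w4d = s0 * (a3 * b4 - b3 * a4) + s1 * (a2 * b3 - b2 * a3)
      + s2 * (a3 * b1 - b3 * a1) - j * (a1 * b4 - b1 * a4)
      - 2 * j2 * (a2 * b4 - b2 * a4) + k * (a1 * b2 - b1 * a2) ->
    hp = p4d - (r * p1d + b1 * pl) -> hw = w4d - (r * w1d + a1 * wl) -> hw = 0 ->
    w1d = p1d + (r * p3d + b3 * (r ^+ 2 * i + r * j + z)) -> p3d = b2 - r * i * b3 ->
    pl = r ^+ 2 * i + r * j + z -> wl = b5 + (r ^+ 2 * i + r * j + z) * b1 ->
    a1 = 1 -> a2 = 0 -> a3 = 0 -> a4 = r ->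
    hp = b5 + (r ^+ 2 + 2 * (r * j2) + k) * b2 - j * (b4 - r * b1)
      + (r * (z + r * j) - r * s0 - s2) * b3.
  move=> H -> -> /eqP; rewrite subr_eq0 => /eqP Hw4 h1 h3 -> eta5_along ha1 ha2 ha3 ha4.
  have -> : p4d = (p4d - w4d) + w4d by ring.
  by rewrite H Hw4 h1 h3 eta5_along ha1 ha2 ha3 ha4; ring.
exact: (alg _ _ _ _ _ _ _ _ _ _ _ _ _ _ _ _ _ _ _ _ _ _ _ _ _ _ _
  (dflat_phi A4 oO sc p w Ox) Hp Hw w4 center_eta1 center_eta3 p5' lamw p1 p2 p3 p4').
Qed.

(** Here the derivative of [eta5] on [p] in the direction [w] is the
    inhomogeneous term.  The derivatives of [fLam] along [p] cancel against
    those in the direction of [eta1]. *)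
Lemma center_eta5 : 'D_w (eta5_along p) x = 'D_p (eta5_along w) x
  - fLamE o1 (G x) * n2 w x - fLamE o2 (G x) * n3 w x - fLamE o3 (G x) * eta4_along w x
  - (2 * (lam x * fI T (c x)) + fJ1 T (c x)) * eta5_along w x
  - fLam (G x) * (fLam (G x) * n3 w x + lam x * 'D_p (n3 w) x).
Proof.
have dL := smooth_on_differentiable smooth_Lam Ox.
have dDl v := smooth_on_differentiable (smooth_on_derive v slam) Ox.
have Hh v v' : 'D_v (eta5_along v') x = 'D_v ('D_v' lam) x
    - (fLam (G x) * 'D_v (n1 v') x + n1 v' x * 'D_v (fLam \o G) x).
  by rewrite -(derive_M v dL (dn1 v')) -(derive_B _ (dDl v') (differentiableM dL (dn1 v'))).
have alg (hp hw ddp ddw p1d w1d p3d pl wl pL wL L l0 l1 l2 l3 a1 a2 a3 a4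
    b1 b2 b3 b4 b5 r i j : R) :
    hp = ddp - (L * p1d + b1 * pL) -> hw = ddw - (L * w1d + a1 * wL) -> ddp = ddw ->
    pL = (2 * r * i + j) * pl + a1 * l0 + a2 * l1 + a3 * l2 + a4 * l3 ->
    wL = (2 * r * i + j) * wl + b1 * l0 + b2 * l1 + b3 * l2 + b4 * l3 ->
    w1d = p1d + (r * p3d + b3 * L) -> pl = L -> wl = b5 + L * b1 ->
    a1 = 1 -> a2 = 0 -> a3 = 0 -> a4 = r ->
    hw = hp - l1 * b2 - l2 * b3 - l3 * (b4 - r * b1) - (2 * (r * i) + j) * b5
      - L * (L * b3 + r * p3d).
  by move=> -> -> -> -> -> -> -> -> -> -> -> ->; ring.
exact: (alg _ _ _ _ _ _ _ _ _ _ _ _ _ _ _ _ _ _ _ _ _ _ _ _ _ _ _ _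
  (Hh p w) (Hh w p) (derive_swap p w oO Ox slam) (derive_Lam p Ox) (derive_Lam w Ox)
  center_eta1 p5' lamw p1 p2 p3 p4').
Qed.

End SecondVariation.
End Lifts.

(** * Elimination to a single equation *)

Section Reduction.
(* Functions of arc length along a geodesic.  A prime, or an added digit for [L]
   and [u], marks a derivative; [L = lambda I], [W = lambda J_2], [M2] and [M3]
   are the derivatives of [fLam] along the second and third frame vectors, and
   [N] is the coefficient of [eta3] in [center_eta4]. *)
Context {R : realType}.
Variable l : R.

Lemma derive_eq_open (f g : R -> R) (s df : R) :
  (forall s, 0 < s < l -> f s = g s) -> 0 < s < l -> is_derive s 1 g df ->
  'D_1 f s = df.
Proof.
move=> fg sl [_ <-]; apply: near_eq_derive.
have : open_nbhs s `]0, l[%classic by split; [exact: interval_open|rewrite /= in_itv].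
by move=> /open_nbhs_nbhs; apply: filterS => r /=; rewrite in_itv; exact: fg.
Qed.

Variables (L L1 L2 J J' W W' A A' K K' lam Lam N M2 M3 : R -> R).

Definition jac_c s := A s - W s - L1 s - L s ^+ 2.
Definition jac_c' s := A' s - W' s - L2 s - 2 * L s * L1 s.
Definition jac_M s := lam s ^+ 2 + 2 * W s + K s.
Definition jac_g s := 2 * L s + J s.
Definition jac_h s := - (2 * L1 s) + jac_c s - 2 * L s * J s - jac_M s.
Definition jac_k s := jac_c' s + J s * jac_c s - jac_M s * L s - N s.
(* The derivative of [fLam] along the fourth frame vector, as given by the Bianchi
   identities. *)
Definition jac_X s := 2 * A s - W s - (J s + L s) ^+ 2 + (J' s + L1 s).
(* [u'''' + jac_P u'' + jac_P' u' + jac_Q u] is what is left after the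
   elimination. *)
Definition jac_P s := 4 * L1 s - 2 * L s ^+ 2 - 3 * A s + 4 * W s + lam s ^+ 2 + K s.
Definition jac_Q s := - 'D_1 jac_k s + M2 s * L s + M3 s + jac_c s * jac_X s
  + jac_g s * jac_k s + Lam s ^+ 2.

Section JacSmooth.
Variable O : set R.
Hypothesis oO : open O.
Hypotheses (sL : smooth_on O L) (sL1 : smooth_on O L1) (sL2 : smooth_on O L2)
  (sJ : smooth_on O J) (sJ' : smooth_on O J') (sW : smooth_on O W)
  (sW' : smooth_on O W') (sA : smooth_on O A) (sA' : smooth_on O A')
  (sK : smooth_on O K) (slam : smooth_on O lam) (sLam : smooth_on O Lam)
  (sN : smooth_on O N) (sM2 : smooth_on O M2) (sM3 : smooth_on O M3).

Ltac smooth := repeat first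
  [ assumption
  | apply: (smooth_onD oO) | apply: (smooth_onN oO)
  | apply: (smooth_onX _ oO) | apply: (smooth_onM oO)
  | exact: smooth_on_cst ].

Lemma jac_P_smooth : smooth_on O jac_P.
Proof. by rewrite /jac_P; smooth. Qed.

Lemma jac_c_smooth : smooth_on O jac_c.
Proof. by rewrite /jac_c; smooth. Qed.

Lemma jac_k_smooth : smooth_on O jac_k.
Proof.
have sc := jac_c_smooth; have sc' : smooth_on O jac_c' by rewrite /jac_c'; smooth.
have sM : smooth_on O jac_M by rewrite /jac_M; smooth.
by rewrite /jac_k; smooth.
Qed.

Lemma jac_Q_smooth : smooth_on O jac_Q.
Proof.
have sc := jac_c_smooth; have sk := jac_k_smooth.
have sk' : smooth_on O ('D_1 jac_k) by exact: smooth_on_derive.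
have sg : smooth_on O jac_g by rewrite /jac_g; smooth.
have sX : smooth_on O jac_X by rewrite /jac_X; smooth.
by rewrite /jac_Q; smooth.
Qed.

End JacSmooth.

Variables (u u1 u2 u3 u4 b2 b4 b5 d : R -> R).
Hypothesis (dL : forall s, 0 < s < l -> is_derive s 1 L (L1 s))
 (dL1 : forall s, 0 < s < l -> is_derive s 1 L1 (L2 s))
 (dJ : forall s, 0 < s < l -> is_derive s 1 J (J' s))
 (dW : forall s, 0 < s < l -> is_derive s 1 W (W' s))
 (dA : forall s, 0 < s < l -> is_derive s 1 A (A' s))
 (dK : forall s, 0 < s < l -> is_derive s 1 K (K' s))
 (dlam : forall s, 0 < s < l -> is_derive s 1 lam (Lam s))
 (dk : forall s, 0 < s < l -> derivable jac_k s 1)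
 (du : forall s, 0 < s < l -> is_derive s 1 u (u1 s))
 (du1 : forall s, 0 < s < l -> is_derive s 1 u1 (u2 s))
 (du2 : forall s, 0 < s < l -> is_derive s 1 u2 (u3 s))
 (du3 : forall s, 0 < s < l -> is_derive s 1 u3 (u4 s)).
(* [E2] is the Bianchi identity [geo_M2]; the other equations are the linearized
   structure equations, with [d] the inhomogeneous term. *)
Hypothesis (E2 : forall s, 0 < s < l ->
    M2 s = 2 * L s * A s + (J s + L s) * jac_M s - lam s * Lam s - N s - A' s)
 (Eu : forall s, 0 < s < l -> 'D_1 u s = b2 s - L s * u s)
 (Eb2 : forall s, 0 < s < l ->
    'D_1 b2 s = - b4 s + (A s - W s) * u s - L s * b2 s)
 (Eb4 : forall s, 0 < s < l ->
    'D_1 b4 s = b5 s + jac_M s * b2 s - J s * b4 s + N s * u s)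
 (Ed : forall s, 0 < s < l -> d s = 'D_1 b5 s - M2 s * b2 s - M3 s * u s
    - jac_X s * b4 s - jac_g s * b5 s - Lam s * (Lam s * u s + lam s * u1 s)).

Lemma jac_b2 s : 0 < s < l -> b2 s = u1 s + L s * u s.
Proof.
move=> sl; have -> : u1 s = 'D_1 u s by have [_ ->] := du sl.
by rewrite Eu // subrK.
Qed.

Lemma jac_b4 s : 0 < s < l -> b4 s = - u2 s - 2 * L s * u1 s + jac_c s * u s.
Proof.
move=> sl; have H := Eb2 sl.
have D : is_derive s 1 (fun s => u1 s + L s * u s) (u2 s + (L s * u1 s + u s * L1 s)).
  have := du1 sl; have := dL sl; have := du sl => ? ? ?.
  by apply: is_derive_eq; rewrite /GRing.scale /=; ring.
rewrite (derive_eq_open jac_b2 sl D) (jac_b2 sl) in H.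
apply/eqP; rewrite -subr_eq0; apply/eqP.
transitivity (b4 s + (u2 s + (L s * u1 s + u s * L1 s)) - (A s - W s) * u s
   + L s * (u1 s + L s * u s)); first by rewrite /jac_c; ring.
by rewrite H; ring.
Qed.

Lemma jac_dc s : 0 < s < l -> is_derive s 1 jac_c (jac_c' s).
Proof.
move=> sl; have := dA sl; have := dW sl; have := dL1 sl; have := dL sl => ? ? ? ?.
by rewrite /jac_c; apply: is_derive_eq; rewrite /jac_c' /GRing.scale /=; ring.
Qed.

Lemma jac_b5 s : 0 < s < l ->
  b5 s = - u3 s - jac_g s * u2 s + jac_h s * u1 s + jac_k s * u s.
Proof.
move=> sl; have H := Eb4 sl.
have D : is_derive s 1 (fun s => - u2 s - 2 * L s * u1 s + jac_c s * u s)
   (- u3 s - 2 * L1 s * u1 s - 2 * L s * u2 s + jac_c' s * u s + jac_c s * u1 s).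
  have := du2 sl; have := du1 sl; have := dL sl; have := du sl; have := jac_dc sl => ? ? ? ? ?.
  by apply: is_derive_eq; rewrite /GRing.scale /=; ring.
rewrite (derive_eq_open jac_b4 sl D) (jac_b2 sl) (jac_b4 sl) in H.
apply/eqP; rewrite -subr_eq0; apply/eqP; move: H.
rewrite /jac_g /jac_h /jac_k.
move: (b5 s) (jac_c s) (jac_c' s) (jac_M s) => b5' c c' M H.
have -> : b5' = b5' + M * (u1 s + L s * u s)
   - J s * (- u2 s - 2 * L s * u1 s + c * u s) + N s * u s
   - (M * (u1 s + L s * u s)
   - J s * (- u2 s - 2 * L s * u1 s + c * u s) + N s * u s) by ring.
by rewrite -H; ring.
Qed.

Lemma jac_dP s : 0 < s < l -> is_derive s 1 jac_P
  (4 * L2 s - 4 * L s * L1 s - 3 * A' s + 4 * W' s + 2 * lam s * Lam s + K' s).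
Proof.
move=> sl; have := dA sl; have := dW sl; have := dL1 sl; have := dL sl.
have := dlam sl; have := dK sl => ? ? ? ? ? ?.
by rewrite /jac_P; apply: is_derive_eq; rewrite /GRing.scale /=; ring.
Qed.

(** After substitution of [jac_b2], [jac_b4] and [jac_b5] the terms in [u3]
    cancel, because the derivative of [fLam] in lambda is [jac_g], and [E2] makes
    the coefficient of [u1] the derivative of that of [u2]. *)
Lemma jacobi_reduction s : 0 < s < l ->
  - d s = u4 s + jac_P s * u2 s + 'D_1 jac_P s * u1 s + jac_Q s * u s.
Proof.
move=> sl; rewrite (Ed sl).
have D : is_derive s 1 (fun s => - u3 s - jac_g s * u2 s + jac_h s * u1 s + jac_k s * u s)
   (- u4 s - (2 * L1 s + J' s) * u2 s - jac_g s * u3 s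
    + (- (2 * L2 s) + jac_c' s - 2 * (L1 s * J s + L s * J' s)
       - (2 * lam s * Lam s + 2 * W' s + K' s)) * u1 s + jac_h s * u2 s
    + 'D_1 jac_k s * u s + jac_k s * u1 s).
  have Dk : is_derive s 1 jac_k ('D_1 jac_k s) by apply: DeriveDef => //; exact: dk.
  have := du3 sl; have := du2 sl; have := du1 sl; have := dL sl; have := du sl.
  have := jac_dc sl; have := dJ sl; have := dlam sl; have := dK sl; have := dW sl.
  have := dL1 sl => ? ? ? ? ? ? ? ? ? ? ?.
  have Dg : is_derive s 1 jac_g (2 * L1 s + J' s).
    by rewrite /jac_g; apply: is_derive_eq; rewrite /GRing.scale /=; ring.
  have Dh : is_derive s 1 jac_h (- (2 * L2 s) + jac_c' s
      - 2 * (L1 s * J s + L s * J' s) - (2 * lam s * Lam s + 2 * W' s + K' s)).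
    by rewrite /jac_h /jac_M; apply: is_derive_eq; rewrite /GRing.scale /=; ring.
  by apply: is_derive_eq; rewrite /GRing.scale /=; ring.
rewrite (derive_eq_open jac_b5 sl D) (jac_b2 sl) (jac_b4 sl) (jac_b5 sl) (E2 sl).
have [_ ->] := jac_dP sl.
rewrite /jac_Q (E2 sl).
move: ('D_1 jac_k s) => k'.
rewrite /jac_k /jac_c' /jac_h /jac_c /jac_g /jac_X /jac_P /jac_M; ring.
Qed.

End Reduction.

(** * Lifts of horizontal curves *)

Section LiftFacts.
Context {R : realType} {X : manifold R 3}.
Variables (D : X -> {vspace 'rV[R]_3}) (F : X -> 'rV[R]_3 -> R).
Variables (Sigma : manifold R 4).
Variables (pr : Sigma -> X) (vec : Sigma -> 'rV[R]_3).
Variables (C : coframe Sigma) (T : invariants Sigma).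
Hypotheses (indic : indicatrix D F pr vec) (A4 : adapted4 D pr vec C T).

Let A0 := adapted4_adapted0 A4.

Lemma smooth_pr (i : chart Sigma) : smooth_map (cim i) (pr \o par i).
Proof. by have [] := indicatrix_smooth indic i. Qed.

Lemma tdiff_pr0 u : tdiff pr u 0 = 0.
Proof.
have := tdiff_linear smooth_pr u 1 0 0.
by rewrite !scale1r !addr0 => /eqP; rewrite -subr_eq subrr => /eqP <-.
Qed.

Lemma tdiff_prZ u a v : tdiff pr u (a *: v) = a *: tdiff pr u v.
Proof. by have := tdiff_linear smooth_pr u a v 0; rewrite !addr0 tdiff_pr0 addr0. Qed.

(** A vertical vector is a difference of two monic vectors; this is where a
    monic vector at [u] is needed. *)
Lemma vertical_forms u m v : monic_vector pr vec u m -> tdiff pr u v = 0 ->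
  ap (eta1 C) u v = 0 /\ ap (eta3 C) u v = 0.
Proof.
move=> mm v0.
have mv : monic_vector pr vec u (1 *: m + v).
  by rewrite /monic_vector (tdiff_linear smooth_pr) v0 addr0 scale1r.
have h1 := adapted0_monic A0 mv; have h3 := (adapted0_null3 A0).2 _ _ mv.
rewrite ap_linear mul1r (adapted0_monic A0 mm) in h1.
rewrite ap_linear mul1r ((adapted0_null3 A0).2 _ _ mm) add0r in h3.
split=> //; apply: (addrI 1); by rewrite h1 addr0.
Qed.

Section Curve.
Context {V : normedModType R}.
Variables (O : set V) (G : V -> Y Sigma).
Hypotheses (oO : open O) (sG : smooth_mapY O G).
(* [A] is an affine line in the parameter space with direction [p]. *)
Variables (A : R -> V) (p : V).
Hypothesis affA : forall h u x, A (h *: u + x) = h *: (u *: p) + A x.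

Notation c := (fst \o G).
Notation lam := (snd \o G : V -> R).

Lemma derive_along (W : normedModType R) (f : V -> W) s :
  'D_1 (f \o A) s = 'D_p f (A s).
Proof. by rewrite (@derive_affine _ _ _ _ A (fun u => u *: p) affA) scale1r. Qed.

Lemma tder_along (n : nat) (M : manifold R n) (f : V -> M) s :
  tder (f \o A) s 1 = tder f (A s) p.
Proof. exact: (derive_along (coord (chart_at (f (A s))) \o f) s). Qed.

Lemma tderY_along s : tderY (G \o A) s 1 = tderY G (A s) p.
Proof. by rewrite /tderY -(tder_along c s) -(derive_along lam s). Qed.

Lemma tder_base s : O (A s) ->
  tder (base pr \o (G \o A)) s 1 = tdiff pr (c (A s)) (tder c (A s) p).
Proof.
move=> Os; rewrite -(tder_comp smooth_pr p oO sG.1 Os).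
exact: (tder_along (pr \o c) s).
Qed.

Variable l : R.
Hypothesis lift : lift_of_horizontal D F pr vec C T l (G \o A).

Lemma lift_monic s : 0 <= s <= l -> O (A s) ->
  monic_vector pr vec (c (A s)) ((speed F pr (G \o A) s)^-1 *: tder c (A s) p).
Proof.
move=> sl Os; have [_ sp E _] := lift sl.
rewrite /monic_vector tdiff_prZ -tder_base // E scalerA mulVf ?scale1r //.
by rewrite gt_eqF.
Qed.

(** The velocity is [speed] times a monic vector, and [eta1] is 1 on the latter:
    length is the integral of a smooth form. *)
Lemma lift_speed s : 0 <= s <= l -> O (A s) ->
  pull c (eta1 C) p (A s) = speed F pr (G \o A) s.
Proof.
move=> sl Os; have [_ sp _ _] := lift sl.
have := adapted0_monic A0 (lift_monic sl Os); rewrite apZ => H.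
by rewrite /pull -[LHS](mulVKf (lt0r_neq0 sp)) H mulr1.
Qed.

Lemma lift_null s : 0 <= s <= l ->
  [/\ pull c (eta2 C) p (A s) = 0, pull c (eta3 C) p (A s) = 0
    & eta4_along C G p (A s) = 0].
Proof.
move=> sl; have [_ _ _ [E2 E3 E4]] := lift sl.
by split; [rewrite -(etaY2 C T)|rewrite -(etaY3 C T)|rewrite -(etaY4 C T)];
  rewrite -tderY_along.
Qed.

End Curve.
End LiftFacts.

(** * First variation of length *)

Section Variation.
Context {R : realType} {X : manifold R 3}.
Variables (D : X -> {vspace 'rV[R]_3}) (F : X -> 'rV[R]_3 -> R).
Variables (Sigma : manifold R 4).
Variables (pr : Sigma -> X) (vec : Sigma -> 'rV[R]_3).
Variables (C : coframe Sigma) (T : invariants Sigma).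
Hypotheses (indic : indicatrix D F pr vec) (A4 : adapted4 D pr vec C T).
Notation mu := (@lebesgue_measure R).

Notation V3 := (R * R * R)%type.
Notation ps := ((1, 0, 0) : V3).
Notation pt := ((0, 1, 0) : V3).
Notation pu := ((0, 0, 1) : V3).

Lemma aff_s (t u : R) h (a s : R) : (h *: a + s, t, u) = h *: (a *: ps) + (s, t, u) :> V3.
Proof. by congr (_, _, _); rewrite /= ?scaler0 ?add0r // [a *: 1]mulr1. Qed.
Lemma aff_t (s u : R) h (a t : R) : (s, h *: a + t, u) = h *: (a *: pt) + (s, t, u) :> V3.
Proof. by congr (_, _, _); rewrite /= ?scaler0 ?add0r // [a *: 1]mulr1. Qed.
Lemma aff_u (s t : R) h (a u : R) : (s, t, h *: a + u) = h *: (a *: pu) + (s, t, u) :> V3.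
Proof. by congr (_, _, _); rewrite /= ?scaler0 ?add0r // [a *: 1]mulr1. Qed.

Lemma derive_s (W : normedModType R) (f : V3 -> W) (s t u : R) :
  'D_1 (fun s => f (s, t, u)) s = 'D_ps f (s, t, u).
Proof. exact: (derive_along (aff_s t u) f s). Qed.
Lemma derive_t (W : normedModType R) (f : V3 -> W) (s t u : R) :
  'D_1 (fun t => f (s, t, u)) t = 'D_pt f (s, t, u).
Proof. exact: (derive_along (aff_t s u) f t). Qed.
Lemma derive_u (W : normedModType R) (f : V3 -> W) (s t u : R) :
  'D_1 (fun u => f (s, t, u)) u = 'D_pu f (s, t, u).
Proof. exact: (derive_along (aff_u s t) f u). Qed.

Lemma differentiable_fst (U W : normedModType R) (z : U * W) : differentiable fst z.
Proof. by apply: linear_differentiable => y; exact: cvg_fst. Qed.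

Lemma differentiable_snd (U W : normedModType R) (z : U * W) : differentiable snd z.
Proof. by apply: linear_differentiable => y; exact: cvg_snd. Qed.

Lemma open_near_box l e : open (near_box l e : set V3).
Proof.
have fc (U W : topologicalType) : continuous (@fst U W) by move=> z; exact: cvg_fst.
have sc (U W : topologicalType) : continuous (@snd U W) by move=> z; exact: cvg_snd.
have oe : open (`](- e), e[%classic : set R) by exact: interval_open.
rewrite (_ : near_box l e =
  (fst @^-1` (fst @^-1` near_seg l e `&` snd @^-1` `](- e), e[%classic))
  `&` snd @^-1` `](- e), e[%classic).
  apply: openI; last by apply: open_comp => // z _; exact: sc.
  apply: open_comp => [z _|]; first exact: fc.
  apply: openI; (apply: open_comp => [z _|]); by [exact: fc|exact: sc|exact: open_near_seg|].
by apply/seteqP; split => -[[s t] u]; rewrite /near_box /near_seg /= !in_itv /=;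
  [by case|by case=> [[? ?] ?]].
Qed.

Lemma smooth_slice l e (f : V3 -> R) (t u : R) : - e < t < e -> - e < u < e ->
  smooth_on (near_box l e) f -> smooth_on (near_seg l e) (fun s => f (s, t, u)).
Proof.
move=> te ue sf.
apply: (@smooth_on_sub _ _ _ ((fun s => (s, t, u)) @^-1` near_box l e)) => [s //|].
exact: (@smooth_on_affine _ _ _ _ (fun s : R => (s, t, u) : V3) (fun a => a *: ps)
  (aff_s t u)).
Qed.

Variables (l : R) (l0 : 0 < l) (G : V3 -> Y Sigma) (e : R) (e0 : 0 < e).
Hypothesis sG : smooth_mapY (near_box l e) G.
Hypothesis lift : forall t u, - e < t < e -> - e < u < e ->
  lift_of_horizontal D F pr vec C T l (fun s => G (s, t, u)).
Variables (b0 b1 : X).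
Hypothesis fixed : forall t u, - e < t < e -> - e < u < e ->
  base pr (G (0, t, u)) = b0 /\ base pr (G (l, t, u)) = b1.

Let oO : open (near_box l e : set V3) := @open_near_box l e.
Notation c := (fst \o G).
Notation lam := (snd \o G : V3 -> R).
Notation n1 := (pull c (eta1 C)).
Notation n2 := (pull c (eta2 C)).
Notation n3 := (pull c (eta3 C)).
Notation k4 := (eta4_along C G).
Notation k5 := (eta5_along C T G).
Notation small t := (- e < t < e).

Let small0 : small 0. Proof. by rewrite e0 oppr_lt0 e0. Qed.

Lemma in_box s t u : 0 <= s <= l -> small t -> small u -> near_box l e (s, t, u).
Proof. by move=> sl te ue; split=> //; exact: (near_segP e0 sl). Qed.

Lemma near_small t : small t -> \forall r \near t, small r.
Proof.
move=> te; have : open_nbhs t `](- e), e[%classic.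
  by split; [exact: interval_open|rewrite /= in_itv].
by move=> /open_nbhs_nbhs; apply: filterS => r /=; rewrite in_itv.
Qed.

Lemma box_speed s t u : 0 <= s <= l -> small t -> small u ->
  speed F pr (fun s => G (s, t, u)) s = n1 ps (s, t, u).
Proof.
move=> sl te ue.
by rewrite (lift_speed indic A4 oO sG (aff_s t u) (lift te ue) sl (in_box sl te ue)).
Qed.

Lemma box_null s t u : 0 <= s <= l -> small t -> small u ->
  [/\ n2 ps (s, t, u) = 0, n3 ps (s, t, u) = 0 & k4 ps (s, t, u) = 0].
Proof. by move=> sl te ue; exact: (lift_null (aff_s t u) (lift te ue) sl). Qed.

Lemma derive_zero_t (f : V3 -> R) s t u : small t ->
  (forall r, small r -> f (s, r, u) = 0) -> 'D_pt f (s, t, u) = 0.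
Proof.
move=> te f0; rewrite -derive_t (near_eq_derive (g := cst 0)) ?derive_cst //.
by apply: filterS (near_small te) => r /f0.
Qed.

Lemma derive_zero_u (f : V3 -> R) s t u : small u ->
  (forall r, small r -> f (s, t, r) = 0) -> 'D_pu f (s, t, u) = 0.
Proof.
move=> ue f0; rewrite -derive_u (near_eq_derive (g := cst 0)) ?derive_cst //.
by apply: filterS (near_small ue) => r /f0.
Qed.

Lemma sn1 v : smooth_on (near_box l e) (n1 v).
Proof. exact: (smooth_n A4 oO sG 0). Qed.
Lemma sn3 v : smooth_on (near_box l e) (n3 v).
Proof. exact: (smooth_n A4 oO sG 2). Qed.

(** The form [Theta = eta1 + lambda eta3] on the variation in [u]. *)
Definition poincare (x : V3) : R := n1 pu x + lam x * n3 pu x.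
Definition first_var (x : V3) : R := - (k5 ps x * n3 pu x).

Lemma poincare_smooth : smooth_on (near_box l e) poincare.
Proof.
apply: (smooth_onD oO (sn1 pu)); apply: (smooth_onM oO _ (sn3 pu)); exact: sG.2.
Qed.

Lemma first_var_smooth : smooth_on (near_box l e) first_var.
Proof.
apply: (smooth_onN oO); apply: (smooth_onM oO _ (sn3 pu)).
exact: (smooth_eta5_along A4 oO sG).
Qed.

(** The variation fixes the base point, hence its derivative is vertical. *)
Lemma endpoint_poincare s b t u : 0 <= s <= l -> small t -> small u ->
  (forall r, small r -> base pr (G (s, t, r)) = b) -> poincare (s, t, u) = 0.
Proof.
move=> sl te ue Hb; rewrite /poincare.
have Os := in_box sl te ue.
have mono := lift_monic indic oO sG (aff_s t u) (lift te ue) sl Os.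
have vert : tdiff pr (c (s, t, u)) (tder c (s, t, u) pu) = 0.
  rewrite -(tder_comp (smooth_pr indic) pu oO sG.1 Os).
  rewrite -(tder_along (aff_u s t) (pr \o c)) /tder.
  rewrite (near_eq_derive (g := cst (coord (chart_at (base pr (G (s, t, u)))) b))).
    by rewrite derive_cst.
  by apply: filterS (near_small ue) => r /Hb rb /=; rewrite -rb.
have [E1 E3] := vertical_forms indic A4 mono vert.
by rewrite /pull E1 E3 mulr0 addr0.
Qed.

(** By [first_variation] the integrand is [first_var] plus an exact derivative,
    whose integral is a difference of two endpoint terms. *)
Lemma length_derive t : small t ->
  derive1 (fun u => curve_length F pr l (fun s => G (s, t, u))) 0 =
  \int[mu]_(s in `[0, l]) first_var (s, t, 0).
Proof.
move=> te.
pose A (z : R * R) : V3 := (z.1, t, z.2).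
have affA h (a z : R * R) : A (h *: a + z) = h *: ((a.1, 0, a.2) : V3) + A z.
  by rewrite /A; congr (_, _, _); rewrite /= scaler0 add0r.
have dA z : differentiable A z.
  apply: differentiable_pair; last exact: differentiable_snd.
  apply: differentiable_pair; last exact: differentiable_cst.
  exact: differentiable_fst.
have sK := smooth_on_affine affA dA (sn1 ps).
have oK : open (A @^-1` near_box l e).
  apply: open_comp => // z _; exact: differentiable_continuous.
transitivity (derive1 (fun r => \int[mu]_(s in `[0, l]) (n1 ps \o A) (s, r)) 0).
  rewrite !derive1E; apply: near_eq_derive; apply: filterS (near_small small0) => r re.
  apply: eq_Rintegral => s; rewrite inE /= in_itv /= => sl.
  exact: box_speed.
rewrite (derive_under_integral e0 oK _ sK); last first.
  by move=> s r sl re; exact: in_box.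
have sF := smooth_slice te small0 poincare_smooth.
have sH := smooth_slice te small0 first_var_smooth.
transitivity (\int[mu]_(s in `[0, l])
    ('D_1 (fun s => poincare (s, t, 0)) s + first_var (s, t, 0))).
  apply: eq_Rintegral => s; rewrite inE /= in_itv /= => sl.
  rewrite (derive_affine affA) derive_s.
  have Os := in_box sl te small0.
  have [z2 z3 z4] := box_null sl te small0.
  have w3 : 'D_pu (n3 ps) (s, t, 0) = 0.
    by apply: derive_zero_u => // r re; have [] := box_null sl te re.
  exact: (first_variation A4 oO sG Os z2 z3 z4 w3).
rewrite RintegralD //.
- rewrite (integral_derive l0 e0 sF).
  rewrite (@endpoint_poincare l b1) ?(@endpoint_poincare 0 b0) ?subrr ?add0r ?lexx ?ltW //.
  + by move=> r re; have [] := fixed te re.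
  + by move=> r re; have [] := fixed te re.
- exact: (smooth_integrable e0 (smooth_on_derive (1 : R) sF)).
- exact: (smooth_integrable e0 sH).
Qed.

Lemma hessian_integral : hessian F pr l G =
  \int[mu]_(s in `[0, l]) 'D_pt first_var (s, 0, 0).
Proof.
pose A (z : R * R) : V3 := (z.1, z.2, 0).
have affA h (a z : R * R) : A (h *: a + z) = h *: ((a.1, a.2, 0) : V3) + A z.
  by rewrite /A; congr (_, _, _); rewrite /= scaler0 add0r.
have dA z : differentiable A z.
  apply: differentiable_pair; last exact: differentiable_cst.
  apply: differentiable_pair; first exact: differentiable_fst.
  exact: differentiable_snd.
have sK := smooth_on_affine affA dA first_var_smooth.
have oK : open (A @^-1` near_box l e).
  apply: open_comp => // z _; exact: differentiable_continuous.
rewrite /hessian.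
transitivity (derive1 (fun r => \int[mu]_(s in `[0, l]) (first_var \o A) (s, r)) 0).
  rewrite !derive1E; apply: near_eq_derive; apply: filterS (near_small small0) => r re.
  exact: length_derive.
rewrite (derive_under_integral e0 oK _ sK); last first.
  by move=> s r sl re; exact: in_box.
apply: eq_Rintegral => s _; exact: (derive_affine affA).
Qed.

End Variation.

(** * The Jacobi operator along a geodesic *)

Section Germs.
Context {R : realType}.

Lemma tder_germ n (M : manifold R n) (f g : R -> M) s :
  (\near s, f s = g s) -> tder f s 1 = tder g s 1.
Proof.
move=> fg; rewrite /tder (nbhs_singleton fg); apply: near_eq_derive.
by apply: filterS fg => r /= ->.
Qed.

Lemma tderY_germ (Sigma : manifold R 4) (f g : R -> Y Sigma) s :
  (\near s, f s = g s) -> tderY f s 1 = tderY g s 1.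
Proof.
move=> fg; rewrite /tderY (@tder_germ _ _ (fst \o f) (fst \o g)).
  congr pair; apply: near_eq_derive.
  by apply: filterS fg => r /= ->.
by apply: filterS fg => r /= ->.
Qed.

Lemma near_open_seg l (s : R) : 0 < s < l -> \forall r \near s, 0 < r < l.
Proof.
move=> sl; have : open_nbhs s `]0, l[%classic.
  by split; [exact: interval_open|rewrite /= in_itv].
by move=> /open_nbhs_nbhs; apply: filterS => r /=; rewrite in_itv.
Qed.

End Germs.

Section Geodesic.
Context {R : realType} {X : manifold R 3}.
Variables (D : X -> {vspace 'rV[R]_3}) (F : X -> 'rV[R]_3 -> R).
Variables (Sigma : manifold R 4).
Variables (pr : Sigma -> X) (vec : Sigma -> 'rV[R]_3).
Variables (C : coframe Sigma) (T : invariants Sigma).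
Hypotheses (indic : indicatrix D F pr vec) (A4 : adapted4 D pr vec C T).
Variables (l : R) (l0 : 0 < l) (G0 : R -> Y Sigma) (e0 : R) (e00 : 0 < e0).
Hypothesis sG0 : smooth_mapY (near_seg l e0) G0.

Notation o0 := (@Ordinal 4 0 isT).
Notation o1 := (@Ordinal 4 1 isT).
Notation o2 := (@Ordinal 4 2 isT).
Notation o3 := (@Ordinal 4 3 isT).

Let Cf : coframing C := adapted0_coframing (adapted4_adapted0 A4).
Let oO : open (near_seg l e0) := @open_near_seg R l e0.

(* The coefficients of [Section Reduction] along the geodesic; [g_M k] is the
   derivative of [fLam] along the frame vector with index [k]. *)
Definition g_lam (s : R) : R := (G0 s).2.
Definition g_L (s : R) : R := g_lam s * fI T (G0 s).1.
Definition g_J (s : R) : R := fJ1 T (G0 s).1.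
Definition g_W (s : R) : R := g_lam s * fJ2 T (G0 s).1.
Definition g_A (s : R) : R := fA1 T (G0 s).1.
Definition g_K (s : R) : R := fK T (G0 s).1.
Definition g_N (s : R) : R := g_lam s * (fZ T (G0 s).1 + g_lam s * fJ1 T (G0 s).1)
  - g_lam s * fS0 T (G0 s).1 - fS2 T (G0 s).1.
Definition g_Lam (s : R) : R := fLam T (G0 s).
Definition g_M (k : 'I_4) (s : R) : R := fLamE C T k (G0 s).

Definition g_P : R -> R := jac_P g_L ('D_1 g_L) g_W g_A g_K g_lam.
Definition g_Q : R -> R := jac_Q g_L ('D_1 g_L) ('D_1 ('D_1 g_L)) g_J ('D_1 g_J)
  g_W ('D_1 g_W) g_A ('D_1 g_A) g_K g_lam g_Lam g_N (g_M o1) (g_M o2).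

Lemma g_fun_smooth g : smooth_fun g -> smooth_on (near_seg l e0) (fun s => g (G0 s).1).
Proof. by move=> sg; exact: (smooth_comp_fun oO sG0.1 sg). Qed.

Lemma g_lam_smooth : smooth_on (near_seg l e0) g_lam.
Proof. exact: sG0.2. Qed.

Lemma g_smooth :
  [/\ smooth_on (near_seg l e0) g_L, smooth_on (near_seg l e0) g_J,
      smooth_on (near_seg l e0) g_W, smooth_on (near_seg l e0) g_A
    & smooth_on (near_seg l e0) g_K] /\
  [/\ smooth_on (near_seg l e0) g_N, smooth_on (near_seg l e0) g_Lam
    & forall k, smooth_on (near_seg l e0) (g_M k)].
Proof.
have [[sI sJ1 sJ2 sK sA1] [sA2 sS0 sS1 sS2]] := adapted4_smooth A4.
have sl := g_lam_smooth; have sZ := smooth_fZ A4.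
split; split.
- by apply: (smooth_onM oO sl); exact: g_fun_smooth.
- exact: g_fun_smooth.
- by apply: (smooth_onM oO sl); exact: g_fun_smooth.
- exact: g_fun_smooth.
- exact: g_fun_smooth.
- apply: (smooth_onB oO); last exact: g_fun_smooth.
  apply: (smooth_onB oO); apply: (smooth_onM oO sl); last exact: g_fun_smooth.
  apply: (smooth_onD oO); first exact: g_fun_smooth.
  by apply: (smooth_onM oO sl); exact: g_fun_smooth.
- exact: (smooth_Lam A4 oO sG0).
- move=> k; apply: (smooth_onD oO); last by apply: g_fun_smooth; exact: smooth_frame_der.
  apply: (smooth_onD oO); apply: (smooth_onM oO); try exact: sl.
  + by apply: (smooth_onX _ oO).
  + by apply: g_fun_smooth; exact: smooth_frame_der.
  + by apply: g_fun_smooth; exact: smooth_frame_der.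
Qed.

Lemma g_P_smooth : smooth_on (near_seg l e0) g_P.
Proof.
have [[sL sJ sW sA sK] [sN sLam sM]] := g_smooth.
exact: (jac_P_smooth oO sL (smooth_on_derive (1 : R) sL) sW sA sK g_lam_smooth).
Qed.

Lemma g_k_smooth : smooth_on (near_seg l e0)
  (jac_k g_L ('D_1 g_L) ('D_1 ('D_1 g_L)) g_J g_W ('D_1 g_W) g_A ('D_1 g_A) g_K g_lam g_N).
Proof.
have [[sL sJ sW sA sK] [sN sLam sM]] := g_smooth.
have sL1 := smooth_on_derive (1 : R) sL.
have sL2 := smooth_on_derive (1 : R) sL1.
have sW1 := smooth_on_derive (1 : R) sW.
have sA1 := smooth_on_derive (1 : R) sA.
have sl := g_lam_smooth.
by apply: jac_k_smooth.
Qed.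

Lemma g_Q_smooth : smooth_on (near_seg l e0) g_Q.
Proof.
have [[sL sJ sW sA sK] [sN sLam sM]] := g_smooth.
have sL1 := smooth_on_derive (1 : R) sL.
have sL2 := smooth_on_derive (1 : R) sL1.
have sJ1 := smooth_on_derive (1 : R) sJ.
have sW1 := smooth_on_derive (1 : R) sW.
have sA1 := smooth_on_derive (1 : R) sA.
have sl := g_lam_smooth.
by apply: jac_Q_smooth; rewrite //; exact: sM.
Qed.

Hypothesis geo_lift : lift_of_horizontal D F pr vec C T l G0.
Hypothesis geo_speed : forall s, 0 <= s <= l -> speed F pr G0 s = 1.
Hypothesis geo_eta5 : forall s, 0 <= s <= l -> etaY C T 5 (G0 s) (tderY G0 s 1) = 0.

Lemma aff_id (h u x : R) : id (h *: u + x) = h *: (u *: (1 : R)) + id x.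
Proof. by rewrite /= [u *: 1]mulr1. Qed.

Section AtTime.
Variables (s : R) (sl : 0 <= s <= l).
Let Os : near_seg l e0 s := near_segP e00 sl.
Notation c := (fst \o G0).

Lemma geo_values : [/\ pull c (eta1 C) 1 s = 1, pull c (eta2 C) 1 s = 0,
  pull c (eta3 C) 1 s = 0 & pull c (phi C) 1 s = g_lam s].
Proof.
have E1 := lift_speed indic A4 oO sG0 aff_id geo_lift sl Os.
have E1' : pull c (eta1 C) 1 s = 1 by rewrite [LHS]E1; exact: geo_speed.
have [E2 E3 E4] := lift_null aff_id geo_lift sl.
split=> //; apply/eqP; rewrite -subr_eq0; apply/eqP.
by move: E4; rewrite /eta4_along [pull c (eta1 C) 1 (id s)]E1' mulr1.
Qed.

Lemma geo_lam : 'D_1 g_lam s = g_Lam s.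
Proof.
have [E1 _ _ _] := geo_values.
have := geo_eta5 sl; rewrite etaY5 /eta5_along E1 mulr1 => H.
by apply/eqP; rewrite -subr_eq0; apply/eqP.
Qed.

Lemma geo_fun g : smooth_fun g ->
  'D_1 (fun r => g (G0 r).1) s =
  frame_der C o0 g (G0 s).1 + g_lam s * frame_der C o3 g (G0 s).1.
Proof.
move=> sg; have [E1 E2 E3 E4] := geo_values.
have := derive_frame A4 oO sG0 1 sg Os.
by rewrite E1 E2 E3 E4 !mul0r mul1r !addr0.
Qed.

Lemma geo_L : 'D_1 g_L s = g_lam s * (frame_der C o0 (fI T) (G0 s).1
    + g_lam s * frame_der C o3 (fI T) (G0 s).1) + fI T (G0 s).1 * g_Lam s.
Proof.
have [[sI _ _ _ _] _] := adapted4_smooth A4.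
rewrite -(geo_fun sI) -geo_lam.
apply: derive_M; first exact: smooth_on_differentiable g_lam_smooth Os.
exact: smooth_on_differentiable (g_fun_smooth sI) Os.
Qed.

(** This lemma and [geo_M3] are the two components of [d (d Theta) = 0] that make
    the eliminated operator formally self-adjoint; both are polynomial in lambda,
    with coefficients given by the Bianchi identities. *)
Lemma geo_M2 : g_M o1 s = 2 * g_L s * g_A s
  + (g_J s + g_L s) * jac_M g_W g_K g_lam s - g_lam s * g_Lam s - g_N s - 'D_1 g_A s.
Proof.
have [[_ _ _ _ sA1] _] := adapted4_smooth A4.
have -> : 'D_1 g_A s = _ := geo_fun sA1.
rewrite /g_M /fLamE (bianchi_I2 A4) (bianchi_J12 A4) (bianchi_Z2 A4).
rewrite /jac_M /g_L /g_A /g_J /g_W /g_K /g_N /g_Lam /fLam -/(g_lam s).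
move: (G0 s).1 (g_lam s) => u r.
move: (frame_der C o0 (fA1 T) u) (frame_der C o3 (fA1 T) u) (fZ T u) => a b z.
ring.
Qed.

Lemma geo_M3 : g_M o3 s = jac_X g_L ('D_1 g_L) g_J ('D_1 g_J) g_W g_A s.
Proof.
have [[_ sJ1 _ _ _] _] := adapted4_smooth A4.
rewrite /jac_X geo_L; have -> : 'D_1 g_J s = _ := geo_fun sJ1.
rewrite /g_M /fLamE (bianchi_I1 A4) (bianchi_Z4 A4).
rewrite /g_L /g_A /g_J /g_W /g_Lam /fLam -/(g_lam s).
move: (G0 s).1 (g_lam s) => u r.
move: (frame_der C o3 (fI T) u) (frame_der C o0 (fJ1 T) u) (frame_der C o3 (fJ1 T) u) => a b z.
move: (fZ T u) => z'.
ring.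
Qed.

End AtTime.

Section Second.
Notation V3 := (R * R * R)%type.
Notation ps := ((1, 0, 0) : V3).
Notation pt := ((0, 1, 0) : V3).
Notation pu := ((0, 0, 1) : V3).
Variables (G : V3 -> Y Sigma) (e : R) (e_gt0 : 0 < e).
Hypothesis GG0 : forall s, 0 <= s <= l -> G (s, 0, 0) = G0 s.
Hypothesis sG : smooth_mapY (near_box l e) G.
Hypothesis lift : forall t u, - e < t < e -> - e < u < e ->
  lift_of_horizontal D F pr vec C T l (fun s => G (s, t, u)).

Let oB : open (near_box l e : set V3) := @open_near_box R l e.
Notation c := (fst \o G).
Notation n1 := (pull c (eta1 C)).
Notation n2 := (pull c (eta2 C)).
Notation n3 := (pull c (eta3 C)).
Notation k4 := (eta4_along C G).
Notation k5 := (eta5_along C T G).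

Let small0 : - e < 0 < e. Proof. by rewrite e_gt0 oppr_lt0 e_gt0. Qed.

Definition eta3_center (v : V3) (s : R) : R := n3 v (s, 0, 0).

Lemma eta3_center_smooth v : smooth_on (near_seg l e) (eta3_center v).
Proof. exact: (smooth_slice small0 small0 (smooth_n A4 oB sG 2 v)). Qed.

Section Center.
Variables (s : R) (sl : 0 < s < l).
Let sl' : 0 <= s <= l. Proof. by case/andP: sl => ? ?; rewrite !ltW. Qed.
Let Os := in_box e_gt0 sl' small0 small0.

Let germ : \forall r \near s, G (r, 0, 0) = G0 r.
Proof.
by apply: filterS (near_open_seg sl) => r /andP[r0 rl]; apply: GG0; rewrite !ltW.
Qed.

Lemma center_values : [/\ n1 ps (s, 0, 0) = 1, n2 ps (s, 0, 0) = 0,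
  n3 ps (s, 0, 0) = 0, k4 ps (s, 0, 0) = 0 & k5 ps (s, 0, 0) = 0].
Proof.
have [E2 E3 E4] := box_null lift sl' small0 small0; split=> //.
  rewrite -(box_speed indic A4 e_gt0 sG lift sl' small0 small0) -(geo_speed sl').
  rewrite /speed /base (GG0 sl'); congr (F _ _); apply: tder_germ.
  by apply: filterS germ => r /= ->.
rewrite -etaY5 -(tderY_along G (aff_s 0 0) s) (GG0 sl') -[RHS](geo_eta5 sl').
by congr etaY; exact: tderY_germ.
Qed.

(** The values of these forms vanish for all [t], not only at the geodesic. *)
Lemma center_zero_t : [/\ 'D_pt (n2 ps) (s, 0, 0) = 0,
  'D_pt (n3 ps) (s, 0, 0) = 0 & 'D_pt (k4 ps) (s, 0, 0) = 0].
Proof.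
by split; apply: (derive_zero_t small0) => r re;
  have [] := box_null lift sl' re small0.
Qed.

(** The other term of the product rule vanishes since [eta5] vanishes along the
    geodesic. *)
Lemma derive_first_var : 'D_pt (first_var C T G) (s, 0, 0) =
  eta3_center pu s * - 'D_pt (k5 ps) (s, 0, 0).
Proof.
have [_ _ _ _ E5] := center_values.
have d5 := smooth_on_differentiable (smooth_eta5_along A4 oB sG ps) Os.
have d3 := smooth_on_differentiable (smooth_n A4 oB sG 2 pu) Os.
have -> : 'D_pt (first_var C T G) (s, 0, 0) =
    - (k5 ps (s, 0, 0) * 'D_pt (n3 pu) (s, 0, 0) + n3 pu (s, 0, 0) * 'D_pt (k5 ps) (s, 0, 0)).
  by rewrite -(derive_M _ d5 d3) -(derive_N _ (differentiableM d5 d3)).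
by rewrite E5 mul0r add0r mulrN.
Qed.

End Center.

Lemma second_variation_jacobi s : 0 < s < l ->
  - 'D_pt (k5 ps) (s, 0, 0) = jacobi_op g_P g_Q (eta3_center pt) s.
Proof.
move=> sl.
have [[sL sJ sW sA sK] [sN sLam sM]] := g_smooth.
have slam := g_lam_smooth.
have clos r : 0 < r < l -> 0 <= r <= l by case/andP => ? ?; rewrite !ltW.
have d0 (f : R -> R) : smooth_on (near_seg l e0) f ->
    forall r, 0 < r < l -> is_derive r 1 f ('D_1 f r).
  move=> sf r /clos rl; apply: is_derive_diff; exact: (smooth_near_seg e00 sf rl).
have d1 (f : R -> R) : smooth_on (near_seg l e) f ->
    forall r, 0 < r < l -> is_derive r 1 f ('D_1 f r).
  move=> sf r /clos rl; apply: is_derive_diff; exact: (smooth_near_seg e_gt0 sf rl).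
have su := eta3_center_smooth pt.
have su1 := smooth_on_derive (1 : R) su.
have su2 := smooth_on_derive (1 : R) su1.
have su3 := smooth_on_derive (1 : R) su2.
have sL1 := smooth_on_derive (1 : R) sL.
pose e' := Num.min e0 e.
have e'0 : 0 < e' by rewrite lt_min e00.
have sP' : smooth_on (near_seg l e') g_P by exact: smooth_seg_min g_P_smooth.
have su' : smooth_on (near_seg l e') (eta3_center pt).
  by rewrite /e' minC; exact: smooth_seg_min su.
rewrite (jacobi_opE _ e'0 sP' su' (near_segP e'0 (clos _ sl))).
have Dlam r : 0 < r < l -> is_derive r 1 g_lam (g_Lam r).
  by move=> rl; rewrite -(geo_lam (clos _ rl)); exact: d0.
have Dk r : 0 < r < l -> derivable (jac_k g_L ('D_1 g_L) ('D_1 ('D_1 g_L)) g_J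
    g_W ('D_1 g_W) g_A ('D_1 g_A) g_K g_lam g_N) r 1.
  move=> /clos rl; apply: diff_derivable; exact: (smooth_near_seg e00 g_k_smooth rl).
have Ctr r (rl : 0 < r < l) := (center_values rl, center_zero_t rl).
have EG r (rl : 0 < r < l) := GG0 (clos r rl).
apply: (@jacobi_reduction _ l g_L ('D_1 g_L) ('D_1 ('D_1 g_L)) g_J ('D_1 g_J)
  g_W ('D_1 g_W) g_A ('D_1 g_A) g_K ('D_1 g_K) g_lam g_Lam g_N (g_M o1) (g_M o2)
  (eta3_center pt) ('D_1 (eta3_center pt)) ('D_1 ('D_1 (eta3_center pt)))
  ('D_1 ('D_1 ('D_1 (eta3_center pt))))
  ('D_1 ('D_1 ('D_1 ('D_1 (eta3_center pt)))))
  (fun s => n2 pt (s, 0, 0)) (fun s => k4 pt (s, 0, 0)) (fun s => k5 pt (s, 0, 0))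
  (fun s => 'D_pt (k5 ps) (s, 0, 0))
  (d0 _ sL) (d0 _ sL1) (d0 _ sJ) (d0 _ sW) (d0 _ sA) (d0 _ sK) Dlam Dk
  (d1 _ su) (d1 _ su1) (d1 _ su2) (d1 _ su3)) => // r rl;
  have [[p1 p2 p3 p4 p5] [w2 w3 w4]] := Ctr r rl;
  have Or := in_box e_gt0 (clos r rl) small0 small0.
- exact: (geo_M2 (clos r rl)).
- rewrite derive_s (center_eta3 A4 oB sG Or p1 p2 p3 p4 w3) /= (EG r rl).
  by [].
- rewrite derive_s (center_eta2 A4 oB sG Or p1 p2 p3 p4 w2) /= (EG r rl).
  by [].
- rewrite derive_s (center_eta4 A4 oB sG Or p1 p2 p3 p4 p5 w3 w4) /= (EG r rl).
  by [].
- have H := center_eta5 A4 oB sG Or p1 p2 p3 p4 p5 w3.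
  rewrite /= (EG r rl) in H.
  have D5 : 'D_1 (fun s => k5 pt (s, 0, 0)) r = 'D_ps (k5 pt) (r, 0, 0) :=
    derive_s (k5 pt) r 0 0.
  have D3 : 'D_1 (eta3_center pt) r = 'D_ps (n3 pt) (r, 0, 0) := derive_s (n3 pt) r 0 0.
  rewrite -(geo_M3 (clos r rl)) D5 D3.
  exact: H.
Qed.

End Second.
End Geodesic.

(** * The second variation *)

Unset Implicit Arguments.

Theorem proposition6p1 (R : realType) (X : manifold R 3)
    (D : X -> {vspace 'rV[R]_3}) (pos : X -> 'rV[R]_3 -> 'rV[R]_3 -> Prop)
    (F : X -> 'rV[R]_3 -> R)
    (Sigma : manifold R 4) (pr : Sigma -> X) (vec : Sigma -> 'rV[R]_3)
    (C : coframe Sigma) (T : invariants Sigma) (l : R) (G0 : R -> Y Sigma) :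
  contact_distribution D -> orientation D pos -> sub_finsler D F ->
  indicatrix D F pr vec -> canonical_coframing D pos pr vec C T ->
  0 < l -> lifted_geodesic D F pr vec C T l G0 ->
  exists P Q : R -> R,
    [/\ smooth_seg l P, smooth_seg l Q, self_adjoint l (jacobi_op P Q)
      & forall G : R * R * R -> Y Sigma,
          admissible_variation D F pr vec C T l G0 G ->
          let V := fun i s => etaY C T i (G (s, 0, 0)) (infinitesimal_t G s) in
          let W := fun i s => etaY C T i (G (s, 0, 0)) (infinitesimal_u G s) in
          hessian F pr l G =
            \int[lebesgue_measure]_(s in `[0, l])
              (W 3%N s * jacobi_op P Q (V 3%N) s)].
Proof.
move=> _ _ _ indic [A4 _] l0 [[e0 e00 sG0] geo_lift geo_speed geo_eta5].
have sP := g_P_smooth A4 sG0; have sQ := g_Q_smooth A4 sG0.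
have segP : smooth_seg l (g_P T G0) by exists e0.
have segQ : smooth_seg l (g_Q C T G0) by exists e0.
exists (g_P T G0), (g_Q C T G0); split => //; first exact: jacobi_self_adjoint.
move=> G [GG0 [e [e_gt0 sG HG]]] V W.
have lift t u (te : - e < t < e) (ue : - e < u < e) :
    lift_of_horizontal D F pr vec C T l (fun s => G (s, t, u)).
  by have [] := HG t u te ue.
have fixed t u (te : - e < t < e) (ue : - e < u < e) :
    base pr (G (0, t, u)) = base pr (G0 0) /\ base pr (G (l, t, u)) = base pr (G0 l).
  by have [] := HG t u te ue.
have EV : V 3 = eta3_center C G (0, 1, 0).
  apply/funext => s; rewrite /eta3_center -(etaY3 C T); congr etaY.
  exact: (tderY_along G (aff_t s 0) 0).
have EW : W 3 = eta3_center C G (0, 0, 1).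
  apply/funext => s; rewrite /eta3_center -(etaY3 C T); congr etaY.
  exact: (tderY_along G (aff_u s 0) 0).
have small0 : - e < 0 < e by rewrite e_gt0 oppr_lt0 e_gt0.
(* The geodesic and the variation extend to different neighbourhoods of the
   segment. *)
pose e' := Num.min e0 e.
have e'0 : 0 < e' by rewrite lt_min e00.
have toe' (f : R -> R) : smooth_on (near_seg l e) f -> smooth_on (near_seg l e') f.
  by move=> sf; rewrite /e' minC; exact: smooth_seg_min sf.
have sV := toe' _ (eta3_center_smooth A4 e_gt0 sG (0, 1, 0)).
have sW := toe' _ (eta3_center_smooth A4 e_gt0 sG (0, 0, 1)).
have oe := @open_near_seg R l e'.
have sR := smooth_onM oe sW (jacobi_op_smooth (smooth_seg_min (e2 := e) sP)
  (smooth_seg_min (e2 := e) sQ) sV).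
have sH := toe' _ (smooth_slice small0 small0
  (smooth_on_derive ((0, 1, 0) : R * R * R) (first_var_smooth A4 sG))).
rewrite (hessian_integral indic A4 l0 e_gt0 sG lift fixed) EV EW.
apply: (eq_integral_open e'0 sH sR) => s sl.
rewrite (derive_first_var indic A4 geo_speed geo_eta5 e_gt0 GG0 sG lift sl).
by rewrite (second_variation_jacobi indic A4 e00 sG0 geo_lift geo_speed geo_eta5
  e_gt0 GG0 sG lift sl).
Qed.
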